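(* Let $s\in[0,1]$. Then the inequality $$|||L(S,T)X|||\le|||H_s(S,T)X|||$$ holds for all $n\in\mathbb{N}$, all unitarily invariant norms $|||\cdot|||$ on $M_n(\mathbb{C})$, all positive semi-definite $S,T\in M_n(\mathbb{C})$ and all $X\in M_n(\mathbb{C})$, if and only if $0\le s\le\frac12$.
   Context: $M_n(\mathbb{C})$ is the set of $n\times n$ complex matrices. A norm $|||\cdot|||$ on $M_n(\mathbb{C})$ is unitarily invariant if $|||UXV|||=|||X|||$ for all unitary $U,V$ and all $X$. The logarithmic mean is $L(a,b)=\frac{a-b}{\log a-\log b}$ for distinct $a,b>0$, $L(a,a)=a$; the Heron mean is $H_s(a,b)=s\sqrt{ab}+(1-s)\frac{a+b}{2}$ for $0\le s\le1$. Means defined on $(0,\infty)^2$ are extended to $[0,\infty)^2$ by continuity (so $L(a,0)=L(0,a)=0$). For a symmetric homogeneous mean $M(a,b)$ and positive semi-definite $S,T\in M_n(\mathbb{C})$ with $S=U\,\mathrm{diag}(\lambda_1,\dots,\lambda_n)U^*$, $T=V\,\mathrm{diag}(\mu_1,\dots,\mu_n)V^*$ ($U,V$ unitary), and $X\in M_n(\mathbb{C})$, define $M(S,T)X:=U\left([M(\lambda_i,\mu_j)]_{i,j=1,\dots,n}\circ(U^*XV)\right)V^*$, where $\circ$ is the Hadamard (entrywise) product. (Thus $L(S,T)X=\int_0^1S^vXT^{1-v}dv$ and $H_s(S,T)X=s\,S^{1/2}XT^{1/2}+(1-s)\frac{SX+XT}{2}$.) *)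

(* Defs.v *)
From HB Require Import structures.
From mathcomp Require Import all_boot all_order all_algebra.
From mathcomp Require Import complex.
From mathcomp Require Import reals exp.
Set Implicit Arguments.
Unset Strict Implicit.
Unset Printing Implicit Defensive.
Import Order.TTheory GRing.Theory Num.Theory.
Local Open Scope ring_scope.
Local Open Scope sesquilinear_scope.
Local Open Scope complex_scope.

(* [ln 0 = 0] by convention in the library, so the boundary values of the
   continuous extension to [0, +oo)^2 have to be given separately. *)
Definition logmean (R : realType) (a b : R) : R :=
  if a == b then a
  else if (a == 0) || (b == 0) then 0
  else (a - b) / (ln a - ln b).

Definition heronmean (R : realType) (s a b : R) : R :=
  s * Num.sqrt (a * b) + (1 - s) * ((a + b) / 2).

Definition hadamard (K : nzRingType) m n (A B : 'M[K]_(m, n)) : 'M[K]_(m, n) :=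
  \matrix_(i, j) (A i j * B i j).

Definition psdmx (R : realType) n (S : 'M[R[i]]_n) : Prop :=
  S \is hermsymmx /\ forall x : 'cV[R[i]]_n, 0 <= (x^t* *m S *m x) 0 0.

Definition mean_kernel (R : realType) (M : R -> R -> R) n
    (l m : 'rV[R]_n) : 'M[R[i]]_n :=
  \matrix_(i, j) (M (l 0 i) (m 0 j))%:C.

(* M(S,T)X, meaningful for S and T positive semi-definite. The library's
   diagonalization reads S = P^-1 diag(l) P with P := spectralmx S unitary, so
   the matrix usually written U is P^t*. The result does not depend on the
   chosen diagonalizations, see [meanmxE]. *)
Definition meanmx (R : realType) (M : R -> R -> R) n
    (S T X : 'M[R[i]]_n) : 'M[R[i]]_n :=
  let U := (spectralmx S)^t* in
  let V := (spectralmx T)^t* in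
  let l := map_mx (@complex.Re R) (spectral_diag S) in
  let m := map_mx (@complex.Re R) (spectral_diag T) in
  U *m hadamard (mean_kernel M l m) (U^t* *m X *m V) *m V^t*.

Record unitarily_invariant_norm (R : realType) n
    (N : 'M[R[i]]_n -> R) : Prop := UnitarilyInvariantNorm {
  uinorm_ge0 : forall X, 0 <= N X;
  uinorm_eq0 : forall X, N X = 0 -> X = 0;
  uinormZ : forall a X, N (a *: X) = Normc.normc a * N X;
  uinormD : forall X Y, N (X + Y) <= N X + N Y;
  uinorm_unitary : forall U V X, U \is unitarymx -> V \is unitarymx ->
    N (U *m X *m V) = N X
}.

Lemma hadamard_intertwine (K : comNzRingType) n (W Z Y A B : 'M[K]_n) :
  (forall i k l j, W i k * Z l j = 0 \/ A k l = B i j) ->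
  W *m hadamard A Y *m Z = hadamard B (W *m Y *m Z).
Proof.
move=> h; apply/matrixP => i j; rewrite !mxE mulr_sumr.
apply: eq_bigr => l _; rewrite !mxE !mulr_suml mulr_sumr.
apply: eq_bigr => k _; rewrite !mxE.
have WZ a b : W i k * (a * b) * Z l j = (W i k * Z l j) * (a * b).
  by rewrite mulrAC.
rewrite WZ [W i k * Y k l * _]mulrAC [RHS]mulrCA.
by have [->|->] := h i k l j; rewrite ?mul0r.
Qed.

Lemma unitary_intertwine (K : numClosedFieldType) n (U P : 'M[K]_n)
    (d e : 'rV[K]_n) i j : U \is unitarymx -> P \is unitarymx ->
  U *m diag_mx d *m U^t* = P *m diag_mx e *m P^t* ->
  (U^t* *m P) i j = 0 \/ d 0 i = e 0 j.
Proof.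
move=> /unitarymxP/mulmx1C uU /unitarymxP/mulmx1C uP h.
have /matrixP/(_ i j) : diag_mx d *m (U^t* *m P) = (U^t* *m P) *m diag_mx e.
  have := congr1 (fun A => U^t* *m A *m P) h.
  by rewrite !mulmxA uU mul1mx -!mulmxA uP mulmx1 !mulmxA.
move: (U^t* *m P) => W; rewrite mul_diag_mx mul_mx_diag !mxE mulrC => hW.
by have [->|nz] := eqVneq (W i j) 0; [left | right; apply: (mulfI nz)].
Qed.

Lemma psdmx_spectralE (R : realType) n (S : 'M[R[i]]_n) : psdmx S ->
  S = (spectralmx S)^t* *m
      diag_mx (map_mx (real_complex R) (map_mx (@complex.Re R) (spectral_diag S)))
      *m ((spectralmx S)^t*)^t*.
Proof.
move=> [Sh _]; rewrite trmxCK.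
have /hermitian_normalmx/orthomx_spectralP := Sh.
rewrite invmx_unitary ?spectral_unitarymx // => {1}->.
congr (_ *m diag_mx _ *m _); apply/matrixP => i j; rewrite !mxE.
by have /mxOverP/(_ i j)/RRe_real := hermitian_spectral_diag_real Sh.
Qed.

Lemma meanmxE (R : realType) (M : R -> R -> R) n (S T X U V : 'M[R[i]]_n)
    (l m : 'rV[R]_n) :
  psdmx S -> psdmx T -> U \is unitarymx -> V \is unitarymx ->
  S = U *m diag_mx (map_mx (real_complex R) l) *m U^t* ->
  T = V *m diag_mx (map_mx (real_complex R) m) *m V^t* ->
  meanmx M S T X =
    U *m hadamard (mean_kernel M l m) (U^t* *m X *m V) *m V^t*.
Proof.
move=> /psdmx_spectralE Ss /psdmx_spectralE Ts uU uV eS eT; rewrite /meanmx.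
have uP : (spectralmx S)^t* \is unitarymx.
  by rewrite trmxC_unitary spectral_unitarymx.
have uQ : (spectralmx T)^t* \is unitarymx.
  by rewrite trmxC_unitary spectral_unitarymx.
rewrite [LHS]/=.
move: (_^t*) (map_mx _ (spectral_diag S)) uP Ss => P p uP Ss.
move: (_^t*) (map_mx _ (spectral_diag T)) uQ Ts => Q q uQ Ts.
have -> : P *m hadamard (mean_kernel M p q) (P^t* *m X *m Q) *m Q^t* =
  U *m ((U^t* *m P) *m hadamard (mean_kernel M p q) (P^t* *m X *m Q) *m
        (Q^t* *m V)) *m V^t*.
  rewrite !mulmxA (unitarymxP uU) mul1mx -!mulmxA (unitarymxP uV) mulmx1.
  by [].
rewrite (@hadamard_intertwine _ _ _ _ _ _ (mean_kernel M l m)); last first.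
  move=> i k a j.
  have [->|] := unitary_intertwine i k uU uP (etrans (esym eS) Ss).
    by rewrite mul0r; left.
  have [->|] := unitary_intertwine a j uQ uV (etrans (esym Ts) eT).
    by rewrite mulr0; left.
  by rewrite !mxE => -[->] [->]; right.
congr (_ *m hadamard _ _ *m _).
by rewrite !mulmxA !mulmxtVK.
Qed.

(* Main.v *)
Require Import Defs.
From mathcomp Require Import all_boot all_order all_algebra.
From mathcomp Require Import complex.
From mathcomp Require Import reals exp.
From mathcomp Require Import boolp classical_sets topology realfun.
From mathcomp Require Import normedtype sequences trigo.
From mathcomp Require Import zify ring lra.
Set Implicit Arguments.
Unset Strict Implicit.
Unset Printing Implicit Defensive.
Import Order.TTheory GRing.Theory Num.Theory.
Import numFieldNormedType.Exports.
Local Open Scope ring_scope.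

(** For positive definite S and T with eigenvalues exp (2 u_i) and exp (2 v_j),
    both means are, up to the common factor exp (u_i + v_j), functions of
    t = u_i - v_j: the logarithmic mean is sinhc t = sinh t / t and the Heron
    mean is s + (1 - s) cosh t. So the inequality compares two entrywise
    multipliers, and semi-definite S and T follow by continuity
    ([logmean_le_heron]).

    Sufficiency. Multiplication of the entries by cos (h t) is the average of
    two unitary equivalences, hence a contraction. As cosh x + cos x differs
    from 2 only at order x^4, the function r |-> N (cosh (r t) Y) is midpoint
    convex up to an error of order h^4; it is even, so it is minimal at r = 0.
    This gives N Y <= N (cosh t Y), an arithmetic-geometric mean inequality
    ([cosh_expansion]). Now sinhc t is the mean of cosh over [-t, t], and the
    trapezoidal rule with two panels gives (1 + cosh t) / 2. Each halving of the
    panels averages the previous value P cosh x with P, which is smaller by the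
    inequality just proved; so the norm decreases along the refinement, down to
    that of sinhc t ([sinhc_le_half_heron]). This is the case s = 1/2. For
    s < 1/2, the kernel with s = 1/2 is a convex combination of the constant 1 and
    the kernel with s, and N Y is at most the value at s = 1/2 because
    (1 + cosh t) / 2 = cosh (t / 2)^2 ([heron_le_half]).

    Necessity. For the operator norm, a contractive multiplier with unit diagonal
    has a positive semi-definite kernel ([contractive_multiplier_psd]). The
    inequality for s therefore makes f t = sinhc t / (s + (1 - s) cosh t) a
    positive definite function, and comparing coefficients at nearby points shows
    that the even Taylor coefficients of f alternate in sign
    ([psd_taylor_sign]): the power series of
    f (i y) = sin y / (y (s + (1 - s) cos y)) has nonnegative coefficients. Such a
    function cannot drop from the value 1 at y = 0 to the value 0 at y = pi, unless
    its series stops converging before pi. When s > 1/2 the denominator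
    s + (1 - s) cos y is at least 2 s - 1 > 0. To do without any discussion of
    convergence, the powers of y are weighted as in the binomial expansion of
    (cos th + i sin th)^n with th = pi / (n + 1), instead of that of exp (i pi). The
    identity between the power series then becomes a finite one, whose one side
    vanishes because sin pi = 0 and whose other side is positive for large n
    ([no_nonneg_moments]). *)

(** * Taylor polynomials of cos, cosh and sinhc *)

Section TaylorTails.
Variable R : realType.
Implicit Types (c : nat -> R) (x y : R).

Lemma series_tail_bound c x y m :
  (forall i, `|c i| <= (i`!%:R)^-1) ->
  (series (fun i => c i * x ^+ i) n @[n --> \oo] --> y)%classic ->
  `|x| <= 1 -> `|y - \sum_(i < m) c i * x ^+ i| <= expR 1 * `|x| ^+ m.
Proof.
move=> cb cy x1; set s := \sum_(i < m) _.
have cvn : ((fun n => `|series (fun i => c i * x ^+ i) n - s|) n @[n --> \oo]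
            --> `|y - s|)%classic.
  by apply: cvg_norm; apply: cvgB => //; exact: cvg_cst.
rewrite -(cvg_lim _ cvn)//; apply: limr_le; first by apply/cvg_ex; eexists; exact: cvn.
near=> n.
have mn : (m <= n)%N by near: n; exact: nbhs_infty_ge.
rewrite seriesEnat /= (big_cat_nat _ mn) //= big_mkord addrAC subrr add0r.
apply: le_trans (ler_norm_sum _ _ _) _.
apply: (@le_trans _ _ (\sum_(m <= i < n) (`|x| ^+ m * (i`!%:R)^-1))).
  apply: ler_sum_nat => i /andP[mi _]; rewrite normrM normrX mulrC ler_pM ?exprn_ge0 //.
  by rewrite ler_wiXn2l.
rewrite -mulr_sumr mulrC ler_wpM2r ?exprn_ge0 //.
apply: le_trans (_ : series (exp_coeff 1) n <= _).
  rewrite seriesEnat /= [leRHS](big_cat_nat _ mn) //= -[leLHS]add0r lerD //.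
    by rewrite sumr_ge0 // => i _; exact: exp_coeff_ge0.
  by apply: ler_sum => i _; rewrite /exp_coeff /= expr1n mul1r.
rewrite /expR; apply: nondecreasing_cvgn_le; last exact: is_cvg_series_exp_coeff.
by apply: nondecreasing_series => i _ _; exact: exp_coeff_ge0.
Unshelve. all: by end_near. Qed.

Lemma expR_taylor m x : `|x| <= 1 ->
  `|expR x - \sum_(i < m) (i`!%:R)^-1 * x ^+ i| <= expR 1 * `|x| ^+ m.
Proof.
apply: (@series_tail_bound (fun i => (i`!%:R)^-1)) => [i|].
  by rewrite ger0_norm ?invr_ge0.
by have := is_cvg_series_exp_coeff x; rewrite /expR exp_coeffE.
Qed.

Lemma cos_taylor m x : `|x| <= 1 ->
  `|cos x - \sum_(i < m) ((~~ odd i)%:R * (-1) ^+ i./2 * (i`!%:R)^-1) * x ^+ i|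
    <= expR 1 * `|x| ^+ m.
Proof.
apply: (@series_tail_bound
  (fun i => (~~ odd i)%:R * (-1) ^+ i./2 * (i`!%:R)^-1)) => [i|].
  rewrite !normrM normrX normrN1 expr1n mulr1 normfV !normr_nat.
  by case: odd; rewrite ?mul0r ?mul1r // invr_ge0.
by have := @is_cvg_series_cos_coeff R x; rewrite unlock cos_coeffE.
Qed.

Definition cosh x := (expR x + expR (- x)) / 2.

(** The value at 0 is the removable singularity. *)
Definition sinhc x := if x == 0 then 1 else (expR x - expR (- x)) / (2 * x).

Lemma coshN x : cosh (- x) = cosh x.
Proof. by rewrite /cosh opprK addrC. Qed.

Lemma cosh0 : cosh 0 = 1.
Proof. by rewrite /cosh oppr0 expR0; field. Qed.

Lemma cosh_norm x : cosh `|x| = cosh x.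
Proof. by case: ler0P => _; rewrite ?coshN. Qed.

Lemma cosh_gt0 x : 0 < cosh x.
Proof. by rewrite /cosh divr_gt0 // addr_gt0 // expR_gt0. Qed.

Lemma coshD_add_coshB x y : cosh (x + y) + cosh (x - y) = 2 * cosh x * cosh y.
Proof. by rewrite /cosh !opprD !opprK !expRD; field. Qed.

Lemma cosh_ge1 x : 1 <= cosh x.
Proof.
have := expR_gt0 x; rewrite /cosh expRN; set e := expR x => e0.
rewrite -subr_ge0.
have -> : (e + e^-1) / 2 - 1 = (e - 1) ^+ 2 / (2 * e).
  by field; rewrite gt_eqF.
by rewrite divr_ge0 ?sqr_ge0 // mulr_ge0 // ltW.
Qed.

Lemma coshx_sqr x : (1 + cosh (2 * x)) / 2 = cosh x ^+ 2.
Proof.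
have := coshD_add_coshB x x; rewrite subrr cosh0 -mulr2n -[x *+ 2]mulr_natl => h.
by rewrite addrC h; field.
Qed.

Lemma cosh_le x y : `|x| <= `|y| -> cosh x <= cosh y.
Proof.
rewrite -(cosh_norm x) -(cosh_norm y).
move: `|x| (normr_ge0 x) => {}x x0 xy.
have := expR_gt0 x; have := expR_gt0 `|y|; rewrite /cosh !expRN.
have : expR x <= expR `|y| by rewrite ler_expR.
have : 1 <= expR x by rewrite -expR0 ler_expR.
move: (expR x) (expR `|y|) => a b a1 ab b0 a0.
rewrite -subr_ge0.
have -> : (b + b^-1) / 2 - (a + a^-1) / 2 = (b - a) * (a * b - 1) / (2 * a * b).
  by field; rewrite !gt_eqF.
by rewrite divr_ge0 ?mulr_ge0 ?subr_ge0 ?(ltW a0) ?(ltW b0) //; nra.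
Qed.

Lemma cosh_taylor m x : `|x| <= 1 ->
  `|cosh x - \sum_(i < m) ((~~ odd i)%:R * (i`!%:R)^-1) * x ^+ i|
    <= expR 1 * `|x| ^+ m.
Proof.
move=> x1; have h1 := expR_taylor m x1.
have h2 : `|- x| <= 1 by rewrite normrN.
have {}h2 := expR_taylor m h2; rewrite normrN in h2.
have -> : \sum_(i < m) ((~~ odd i)%:R * (i`!%:R)^-1) * x ^+ i =
  (\sum_(i < m) (i`!%:R)^-1 * x ^+ i + \sum_(i < m) (i`!%:R)^-1 * (- x) ^+ i) / 2.
  rewrite -big_split /= mulr_suml; apply: eq_bigr => i _.
  by rewrite exprNn -signr_odd; case: odd => /=; rewrite ?expr0 ?expr1; field;
    rewrite pnatr_eq0 -lt0n fact_gt0.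
move: h1 h2; rewrite /cosh !ler_norml; move: (\sum_(i < m) _) (\sum_(i < m) _).
by move=> a b /andP[? ?] /andP[? ?]; apply/andP; split; lra.
Qed.

Lemma sinhc_taylor m x : `|x| <= 1 ->
  `|sinhc x - \sum_(i < m) ((~~ odd i)%:R * (i.+1`!%:R)^-1) * x ^+ i|
    <= expR 1 * `|x| ^+ m.
Proof.
move=> x1; rewrite /sinhc; have [->|x0] := eqVneq x 0.
  case: m => [|m]; last first.
    rewrite big_ord_recl /= big1 ?addr0; last first.
      by move=> i _; rewrite exprS mul0r mulr0.
    by rewrite invr1 !mulr1 subrr normr0 mulr_ge0 ?expR_ge0 ?exprn_ge0.
  by rewrite big_ord0 subr0 normr1 expr0 mulr1 ltW // pexpR_gt1.
have h1 := expR_taylor m.+1 x1.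
have h2 : `|- x| <= 1 by rewrite normrN.
have {}h2 := expR_taylor m.+1 h2; rewrite normrN in h2.
rewrite -(@ler_pM2r _ `|x|) ?normr_gt0 // -mulrA -exprSr -normrM.
rewrite mulrBl mulr_suml.
have -> : \sum_(i < m) ((~~ odd i)%:R * (i.+1`!%:R)^-1) * x ^+ i * x =
  (\sum_(i < m.+1) (i`!%:R)^-1 * x ^+ i
   - \sum_(i < m.+1) (i`!%:R)^-1 * (- x) ^+ i) / 2.
  rewrite -sumrB mulr_suml [RHS]big_ord_recl !expr0 subrr mul0r add0r.
  apply: eq_bigr => i _; rewrite !lift0 [(- x) ^+ _]exprNn -signr_odd /= exprSr.
  by case: odd => /=; rewrite ?expr0 ?expr1; field;
    rewrite pnatr_eq0 -lt0n fact_gt0.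
have -> : (expR x - expR (- x)) / (2 * x) * x = (expR x - expR (- x)) / 2.
  by field.
move: h1 h2; rewrite !ler_norml; move: (\sum_(i < _) _) (\sum_(i < _) _).
by move=> a b /andP[? ?] /andP[? ?]; apply/andP; split; lra.
Qed.

(** The quadratic terms cancel. The exponent has to exceed 2, so that the errors
    of m^2 midpoint inequalities with step 1 / m still sum to a null sequence. *)
Lemma cosh_cos_bound x : `|x| <= 1 ->
  `|cosh x + cos x - 2| <= 2 * expR 1 * `|x| ^+ 4.
Proof.
move=> x1; have := cosh_taylor 4 x1; have := cos_taylor 4 x1.
rewrite !big_ord_recl !big_ord0 /=.
have -> : (2`! = 2)%N by [].
have -> : (0`! = 1)%N by [].
rewrite !mul0r !mul1r !expr0 !invr1 !add0r !addr0 !mulr1 expr1.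
rewrite !ler_norml => /andP[? ?] /andP[? ?]; apply/andP; split; lra.
Qed.

Lemma sinhc_double x : sinhc (2 * x) = cosh x * sinhc x.
Proof.
rewrite /sinhc mulf_eq0 pnatr_eq0 /=; case: eqVneq => [->|x0].
  by rewrite cosh0 mulr1.
rewrite /cosh (_ : 2 * x = x + x); last by ring.
by rewrite opprD !expRD; field; rewrite -mulr2n mulrn_eq0.
Qed.

End TaylorTails.

(** * Entrywise multipliers and unitarily invariant norms *)

(** The second inequality is the midpoint inequality at 0 for an even sequence.
    It bounds the first slope below by - c, each later slope loses at most a
    further c, and there are m slopes. *)
Lemma almost_midpoint_convex (R : realType) (g : nat -> R) (c : R) m :
  0 <= c -> 2 * g 0%N <= 2 * g 1%N + c ->
  (forall k, (k < m)%N -> 2 * g k.+1 <= g k + g k.+2 + c) ->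
  g 0%N <= g m + m%:R ^+ 2 * c.
Proof.
move=> c0 g0 gS.
have step k : (k <= m)%N -> g k - g k.+1 <= k.+1%:R * c.
  elim: k => [|k IH] km; first by rewrite mul1r; lra.
  have := IH (ltnW km); have := gS _ km.
  by rewrite -[k.+2]addn1 natrD mulrDl mul1r; lra.
have {}step k : (k <= m)%N -> g 0%N <= g k + k%:R ^+ 2 * c.
  elim: k => [|k IH] km; first by rewrite expr0n mul0r addr0.
  have := IH (ltnW km); have := step _ (ltnW km); rewrite -natr1.
  by have : 0 <= k%:R :> R by []; nra.
exact: step.
Qed.

Section SchurMultipliers.
Variables (R : realType) (n : nat).
Local Open Scope complex_scope.
Local Open Scope sesquilinear_scope.
Implicit Types (k l : 'I_n -> 'I_n -> R) (Y : 'M[R[i]]_n) (u v : 'I_n -> R).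

Definition schur k Y : 'M[R[i]]_n := \matrix_(i, j) ((k i j)%:C * Y i j).

Lemma eq_schur k l Y : k =2 l -> schur k Y = schur l Y.
Proof. by move=> kl; apply/matrixP => i j; rewrite !mxE kl. Qed.

Lemma schur1 Y : schur (fun _ _ => 1) Y = Y.
Proof. by apply/matrixP => i j; rewrite !mxE mul1r. Qed.

Lemma schurM k l Y : schur k (schur l Y) = schur (fun i j => k i j * l i j) Y.
Proof. by apply/matrixP => i j; rewrite !mxE mulrA rmorphM. Qed.

Lemma schurD k l Y : schur (fun i j => k i j + l i j) Y = schur k Y + schur l Y.
Proof. by apply/matrixP => i j; rewrite !mxE rmorphD mulrDl. Qed.

Lemma schurZ a k Y : schur (fun i j => a * k i j) Y = a%:C *: schur k Y.
Proof. by apply/matrixP => i j; rewrite !mxE rmorphM mulrA. Qed.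

Definition cis (x : R) : R[i] := cos x +i* sin x.

Lemma cis_unitary (d : 'I_n -> R) :
  diag_mx (\row_i cis (d i)) \is unitarymx.
Proof.
apply/unitarymxP; apply/matrixP => i j; rewrite mul_diag_mx !mxE.
rewrite eq_sym; case: eqVneq => [->|_]; last by rewrite mulr0n rmorph0 mulr0.
rewrite !mulr1n; apply/eqP; rewrite eq_complex /= !mulrN opprK -!expr2.
by rewrite cos2Dsin2 eqxx /= mulrC addNr.
Qed.

Lemma kernel_bound k : exists2 B : R, 0 <= B & forall i j, `|k i j| <= B.
Proof.
exists (\sum_i \sum_j `|k i j|); first by do 2! apply: sumr_ge0 => ? _.
move=> i j; rewrite (bigD1 i) //= (bigD1 j) //= -addrA lerDl addr_ge0 //.
  by apply: sumr_ge0.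
by do 2! apply: sumr_ge0 => ? _.
Qed.

Section Norm.
Variables (N : 'M[R[i]]_n -> R) (hN : unitarily_invariant_norm N).

Lemma uinormZr (a : R) Y : N (a%:C *: Y) = `|a| * N Y.
Proof. by rewrite (uinormZ hN) /= expr0n addr0 sqrtr_sqr. Qed.

Lemma uinormN Y : N (- Y) = N Y.
Proof.
by rewrite -scaleN1r -(rmorph1 (real_complex R)) -rmorphN uinormZr normrN1 mul1r.
Qed.

Lemma uinorm0 : N 0 = 0.
Proof. by rewrite -(scale0r 0) (uinormZr 0) normr0 mul0r. Qed.

Lemma uinorm_triangle Y Z : N Y <= N Z + N (Y - Z).
Proof. by apply: le_trans (uinormD hN _ _); rewrite subrKC. Qed.

Lemma uinorm_sum (I : Type) (r : seq I) (F : I -> 'M[R[i]]_n) :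
  N (\sum_(i <- r) F i) <= \sum_(i <- r) N (F i).
Proof.
elim: r => [|a r IH]; first by rewrite !big_nil uinorm0.
by rewrite !big_cons; apply: le_trans (uinormD hN _ _) _; rewrite lerD2l.
Qed.

Lemma schur_small Y : exists2 B : R, 0 <= B &
  forall k (e : R), (forall i j, `|k i j| <= e) -> N (schur k Y) <= B * e.
Proof.
exists (\sum_i \sum_j N (Y i j *: delta_mx i j)).
  by do 2! apply: sumr_ge0 => ? _; exact: uinorm_ge0 hN _.
move=> k e ke; rewrite [schur k Y]matrix_sum_delta mulr_suml.
apply: le_trans (uinorm_sum _ _) _; apply: ler_sum => i _.
rewrite mulr_suml; apply: le_trans (uinorm_sum _ _) _; apply: ler_sum => j _.
rewrite mxE -scalerA uinormZr mulrC ler_wpM2l //; exact: uinorm_ge0 hN _.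
Qed.

Lemma schur_convex k l (a b : R) Y : 0 <= a -> 0 <= b ->
  N (schur (fun i j => a * k i j + b * l i j) Y)
    <= a * N (schur k Y) + b * N (schur l Y).
Proof.
move=> a0 b0; rewrite schurD !schurZ; apply: le_trans (uinormD hN _ _) _.
by rewrite !uinormZr !ger0_norm.
Qed.

(** The form in which all limits of kernels are taken below: approximate both
    kernels entrywise by kernels that satisfy the inequality. *)
Lemma schur_closed k l Y :
  (forall e : R, 0 < e -> exists k' l', [/\ N (schur k' Y) <= N (schur l' Y),
     forall i j, `|k i j - k' i j| <= e & forall i j, `|l' i j - l i j| <= e]) ->
  N (schur k Y) <= N (schur l Y).
Proof.
move=> H; have [B B0 hB] := schur_small Y.
apply/ler_addgt0Pr => e e0.
have e'0 : 0 < e / (2 * (B + 1)) by rewrite divr_gt0 // mulr_gt0 // ltr_wpDl.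
have [k' [l' [h1 h2 h3]]] := H _ e'0.
have hBe : B * (e / (2 * (B + 1))) <= e / 2.
  have -> : e / 2 = (B + 1) * (e / (2 * (B + 1))).
    by field; rewrite gt_eqF // ltr_wpDl.
  by rewrite ler_wpM2r ?(ltW e'0) // lerDl.
have sub a b : schur a Y - schur b Y = schur (fun i j => a i j - b i j) Y.
  by apply/matrixP => i j; rewrite !mxE rmorphB mulrBl.
have := uinorm_triangle (schur k Y) (schur k' Y).
have := uinorm_triangle (schur l' Y) (schur l Y).
have := hB _ _ h2; have := hB _ _ h3; rewrite -!sub; lra.
Qed.

(** 2 cos (a - b) = e^(ia) e^(-ib) + e^(-ia) e^(ib), and each summand acts on the
    matrix by multiplication with diagonal unitary matrices. *)
Lemma cos_contraction (h : R) u v Y :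
  N (schur (fun i j => cos (h * (u i - v j))) Y) <= N Y.
Proof.
pose D (d : 'I_n -> R) := diag_mx (\row_i cis (d i)).
pose X1 := D (fun i => h * u i) *m Y *m D (fun j => - (h * v j)).
pose X2 := D (fun i => - (h * u i)) *m Y *m D (fun j => h * v j).
have -> : schur (fun i j => cos (h * (u i - v j))) Y = (2^-1)%:C *: (X1 + X2).
  apply/matrixP => i j; rewrite /X1 /X2 /D !mul_mx_diag !mul_diag_mx !mxE.
  have -> : cis (h * u i) * Y i j * cis (- (h * v j)) +
            cis (- (h * u i)) * Y i j * cis (h * v j) =
      (cis (h * u i) * cis (- (h * v j)) +
            cis (- (h * u i)) * cis (h * v j)) * Y i j by ring.
  rewrite mulrA; congr (_ * _); rewrite mulrBr cosB /cis !cosN !sinN.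
  by apply/eqP; rewrite eq_complex /=; apply/andP; split; apply/eqP; field.
rewrite uinormZr ger0_norm ?invr_ge0 // mulrC ler_pdivrMr //.
apply: le_trans (uinormD hN _ _) _.
by rewrite !(uinorm_unitary hN) ?cis_unitary // mulrDr mulr1.
Qed.

(** Let Z be the matrix whose norm is on the left. Up to an error of order h^4,
    2 Z is the sum of cosh (h t) Z and cos (h t) Z, and the second has norm at
    most N Z; by the addition formula 2 cosh (h t) Z is the sum of the two matrices
    on the right. T bounds the |u_i - v_j|, so h T <= 1 puts h t where the Taylor
    bound holds. *)
Lemma cosh_almost_midpoint u v Y : exists2 C : R, 0 <= C & exists2 T : R, 0 < T &
  forall r h : R, 0 <= r <= 1 -> 0 <= h -> h * T <= 1 ->
  2 * N (schur (fun i j => cosh (r * (u i - v j))) Y) <=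
  N (schur (fun i j => cosh ((r + h) * (u i - v j))) Y) +
  N (schur (fun i j => cosh ((r - h) * (u i - v j))) Y) + C * h ^+ 4.
Proof.
have [T' T'0 hT'] := kernel_bound (fun i j => u i - v j).
pose T := T' + 1; have T0 : 0 < T by rewrite ltr_wpDl.
have hT i j : `|u i - v j| <= T by rewrite (le_trans (hT' i j)) // lerDl.
have [B B0 hB] := schur_small Y.
exists (2 * (B * (2 * expR 1 * T ^+ 4 * cosh T))).
  rewrite mulr_ge0 // mulr_ge0 // mulr_ge0 ?(ltW (cosh_gt0 _)) //.
  by rewrite mulr_ge0 ?exprn_ge0 ?(ltW T0) // mulr_ge0 ?expR_ge0.
exists T => // r h /andP[r0 r1] h0 hT1.
set Z := schur (fun i j => cosh (r * (u i - v j))) Y.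
pose E i j := (cosh (h * (u i - v j)) + cos (h * (u i - v j)) - 2)
              * cosh (r * (u i - v j)).
have hE i j : `|E i j| <= 2 * expR 1 * T ^+ 4 * cosh T * h ^+ 4.
  have ht : `|h * (u i - v j)| <= h * T by rewrite normrM (ger0_norm h0) ler_wpM2l.
  rewrite normrM mulrAC ler_pM //.
    apply: le_trans (cosh_cos_bound _) _; first exact: le_trans ht hT1.
    rewrite -[leRHS]mulrA ler_wpM2l ?mulr_ge0 ?expR_ge0 // -exprMn (mulrC T).
    by apply: lerXn2r => //; rewrite nnegrE ?mulr_ge0 // ltW.
  rewrite ger0_norm ?(ltW (cosh_gt0 _)) //; apply: cosh_le.
  by rewrite normrM (ger0_norm r0) (gtr0_norm T0) -[leRHS]mul1r ler_pM.
have NE := hB _ _ hE.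
have e1 : schur (fun i j => cosh (h * (u i - v j))) Z +
          schur (fun i j => cos (h * (u i - v j))) Z - schur E Y = 2%:C *: Z.
  rewrite /Z; apply/matrixP => i j; rewrite !mxE /E.
  move: (cosh _) (cos _) (cosh (h * _)) (Y i j) => a b c y; ring.
have e2 : 2%:C *: schur (fun i j => cosh (h * (u i - v j))) Z =
   schur (fun i j => cosh ((r + h) * (u i - v j))) Y +
   schur (fun i j => cosh ((r - h) * (u i - v j))) Y.
  rewrite /Z; apply/matrixP => i j; rewrite !mxE.
  rewrite -mulrDl -rmorphD (mulrDl r h) (mulrBl _ r h) coshD_add_coshB.
  move: (cosh _) (cosh (h * _)) (Y i j) => a b y; ring.
have h1 : 2 * N Z <= N (schur (fun i j => cosh (h * (u i - v j))) Z) + N Z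
                     + N (schur E Y).
  have -> : 2 * N Z = N (2%:C *: Z) by rewrite uinormZr ger0_norm.
  rewrite -e1; apply: le_trans (uinormD hN _ _) _.
  rewrite uinormN lerD2r; apply: le_trans (uinormD hN _ _) _.
  by rewrite lerD2l cos_contraction.
have h2 : 2 * N (schur (fun i j => cosh (h * (u i - v j))) Z) <=
   N (schur (fun i j => cosh ((r + h) * (u i - v j))) Y) +
   N (schur (fun i j => cosh ((r - h) * (u i - v j))) Y).
  rewrite -[leLHS]/(2 * N _) -(ger0_norm (ler0n R 2)) -uinormZr e2.
  exact: uinormD hN _ _.
lra.
Qed.

(** The arithmetic-geometric mean inequality for unitarily invariant norms: the
    map r |-> N (cosh (r t) Y) is even and convex, hence minimal at r = 0. *)
Lemma cosh_expansion u v Y :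
  N Y <= N (schur (fun i j => cosh (u i - v j)) Y).
Proof.
have [C C0 [T T0 H]] := cosh_almost_midpoint u v Y.
apply/ler_addgt0Pr => e e0.
have := archi_boundP (addr_ge0 (ltW T0) (divr_ge0 C0 (ltW e0))).
set m := Num.bound _ => mb.
have CE0 : 0 <= C / e by rewrite divr_ge0 // ltW.
have m0 : 0 < m%:R :> R by apply: le_lt_trans mb; rewrite addr_ge0 // ltW.
have Tm : m%:R^-1 * T <= 1 by rewrite mulrC ler_pdivrMr //; lra.
have Ce : C * m%:R ^- 2 <= e.
  have m1 : 1 <= m%:R :> R by rewrite ler1n -(ltr0n R).
  rewrite ler_pdivrMr ?exprn_gt0 //.
  have : C <= e * m%:R by rewrite mulrC -ler_pdivrMr //; lra.
  by nra.
pose g (k : nat) := N (schur (fun i j => cosh (k%:R / m%:R * (u i - v j))) Y).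
have := @almost_midpoint_convex _ g (C * m%:R^-1 ^+ 4) m.
have -> : g 0%N = N Y.
  by rewrite /g -[in RHS](schur1 Y); congr N; apply: eq_schur => i j;
    rewrite !mul0r cosh0.
have -> : g m = N (schur (fun i j => cosh (u i - v j)) Y).
  by congr N; apply: eq_schur => i j; rewrite divff ?mul1r // gt_eqF.
have -> : m%:R ^+ 2 * (C * m%:R^-1 ^+ 4) = C * m%:R ^- 2.
  by field; rewrite gt_eqF.
have mi0 : 0 <= m%:R^-1 :> R by rewrite invr_ge0 ltW.
set Nc := N (schur _ _); move=> key.
apply: le_trans (_ : Nc + C * m%:R ^- 2 <= _); last by rewrite lerD2l.
apply: key.
- by rewrite mulr_ge0 // exprn_ge0.
- have := H 0 _ _ mi0 Tm; rewrite lexx ler01 => /(_ isT).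
  have -> : N (schur (fun i j => cosh (0 * (u i - v j))) Y) = N Y.
    by congr N; rewrite -[RHS]schur1; apply: eq_schur => i j; rewrite mul0r cosh0.
  rewrite add0r sub0r /g mul1r.
  have -> : N (schur (fun i j => cosh (- m%:R^-1 * (u i - v j))) Y) =
            N (schur (fun i j => cosh (m%:R^-1 * (u i - v j))) Y).
    by congr N; apply: eq_schur => i j; rewrite mulNr coshN.
  by rewrite [2 * N (schur _ _)]mulr_natl mulr2n.
- move=> k km.
  have kin : 0 <= (k.+1%:R / m%:R : R) <= 1.
    apply/andP; split; first by rewrite divr_ge0 // ltW.
    by rewrite ler_pdivrMr // mul1r ler_nat.
  have := H _ _ kin mi0 Tm; rewrite /g.
  have -> : k.+1%:R / m%:R + m%:R^-1 = k.+2%:R / m%:R :> R.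
    by rewrite -[k.+2]addn1 natrD mulrDl mul1r.
  have -> : k.+1%:R / m%:R - m%:R^-1 = k%:R / m%:R :> R.
    by rewrite -[k.+1]addn1 natrD mulrDl mul1r addrK.
  by rewrite [X in X + C * _]addrC.
Qed.

End Norm.
End SchurMultipliers.

(** * The logarithmic mean below the Heron mean *)

Section HeronBound.
Variables (R : realType) (n : nat).
Local Open Scope complex_scope.
Variables (N : 'M[R[i]]_n -> R) (hN : unitarily_invariant_norm N).
Implicit Types (u v : 'I_n -> R) (Y : 'M[R[i]]_n) (r s x : R).

(** Since (1 + cosh t) / 2 = cosh (t / 2)^2, this is [cosh_expansion] used
    twice. *)
Lemma half_heron_expansion u v Y :
  N Y <= N (schur (fun i j => (1 + cosh (u i - v j)) / 2) Y).
Proof.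
pose u' i := u i / 2; pose v' i := v i / 2.
apply: le_trans (cosh_expansion hN u' v' Y) _.
apply: le_trans (cosh_expansion hN u' v' _) _.
rewrite schurM le_eqVlt; apply/orP; left; apply/eqP; congr N.
apply: eq_schur => i j; rewrite -expr2 -coshx_sqr; congr ((1 + cosh _) / 2).
by rewrite /u' /v'; field.
Qed.

(** The kernel for 1/2 is a convex combination, with weight b on the kernel for s,
    of that kernel and of 1; the weight of 1 is absorbed by
    [half_heron_expansion]. *)
Lemma heron_le_half s u v Y : 0 <= s <= 1 / 2 ->
  N (schur (fun i j => (1 + cosh (u i - v j)) / 2) Y) <=
  N (schur (fun i j => s + (1 - s) * cosh (u i - v j)) Y).
Proof.
move=> /andP[s0 s1].
have s2 : 0 < 1 - s by lra.
(* b (1 - s) = 1/2 matches the coefficients of cosh. *)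
pose b := (2 * (1 - s))^-1; have b0 : 0 < b by rewrite invr_gt0 mulr_gt0.
have b1 : b <= 1 by rewrite invf_le1 ?mulr_gt0 //; lra.
have a0 : 0 <= 1 - b by lra.
have := schur_convex hN (fun _ _ => 1)
  (fun i j => s + (1 - s) * cosh (u i - v j)) Y a0 (ltW b0).
rewrite schur1 (_ : schur _ Y = schur (fun i j => (1 + cosh (u i - v j)) / 2) Y).
  by have := half_heron_expansion u v Y; nra.
apply: eq_schur => i j; rewrite /b; field.
by rewrite gt_eqF.
Qed.

(** Viete's product: it times sinhc (x / 2^m) is sinhc x, so its limit is
    sinhc x. *)
Fixpoint coshprod m x : R :=
  if m is m'.+1 then coshprod m' x * cosh (x / 2 ^+ m) else 1.

Lemma mul2_div_exp2 m x : 2 * (x / 2 ^+ m.+1) = x / 2 ^+ m.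
Proof. by rewrite exprS; field; rewrite expf_neq0 ?pnatr_eq0. Qed.

Lemma coshprod_sinhc m x : coshprod m x * sinhc (x / 2 ^+ m) = sinhc x.
Proof.
elim: m => [|m IH] /=; first by rewrite mul1r expr0 divr1.
by rewrite -mulrA -sinhc_double mul2_div_exp2 IH.
Qed.

Lemma coshprod_ge0 m x : 0 <= coshprod m x.
Proof.
by elim: m => [|m IH] //=; rewrite mulr_ge0 // ltW // cosh_gt0.
Qed.

(** The left kernel is the trapezoidal rule with 2^(m+1) panels for the mean of
    cosh over [-t, t]. Refining it replaces P cosh x by (P + P cosh x) / 2, where
    N (P Y) <= N (P cosh x Y) by [cosh_expansion]. *)
Lemma trapezoid_le m u v Y :
  N (schur (fun i j => coshprod m.+1 (u i - v j) *
                       cosh ((u i - v j) / 2 ^+ m.+1)) Y) <=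
  N (schur (fun i j => (1 + cosh (u i - v j)) / 2) Y).
Proof.
elim: m => [|m IH].
  rewrite le_eqVlt; apply/orP; left; apply/eqP; congr N; apply: eq_schur => i j.
  by rewrite /= mul1r -expr2 -coshx_sqr mul2_div_exp2 expr0 divr1.
apply: le_trans IH.
set P := fun i j => coshprod m.+1 (u i - v j).
pose u' i := u i / 2 ^+ m.+1; pose v' i := v i / 2 ^+ m.+1.
have h2 : (0 : R) <= 1 / 2 by lra.
have := schur_convex hN P (fun i j => P i j * cosh ((u i - v j) / 2 ^+ m.+1))
  Y h2 h2.
rewrite (_ : schur (fun i j => 1 / 2 * P i j + _) Y = schur (fun i j =>
  coshprod m.+2 (u i - v j) * cosh ((u i - v j) / 2 ^+ m.+2)) Y); last first.
  apply: eq_schur => i j.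
  rewrite -[coshprod m.+2 _]/(P i j * cosh ((u i - v j) / 2 ^+ m.+2)).
  by rewrite -(mulrA (P i j)) -expr2 -coshx_sqr mul2_div_exp2 /P; field.
have := cosh_expansion hN u' v' (schur P Y); rewrite schurM.
rewrite (_ : schur (fun i j => cosh (u' i - v' j) * P i j) Y =
  schur (fun i j => P i j * cosh ((u i - v j) / 2 ^+ m.+1)) Y).
  by set a := N _; set b := N _; lra.
by apply: eq_schur => i j /=; rewrite [RHS]mulrC /u' /v' -mulrBl.
Qed.

(** The error of the trapezoidal rule is P (cosh y - sinhc y) with
    y = t / 2^(m+1), and P stays bounded because P sinhc y = sinhc t. *)
Lemma sinhc_le_half_heron u v Y :
  N (schur (fun i j => sinhc (u i - v j)) Y) <=
  N (schur (fun i j => (1 + cosh (u i - v j)) / 2) Y).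
Proof.
apply: (schur_closed hN) => e e0.
have [T' T'0 hT'] := kernel_bound (fun i j => u i - v j).
pose T := T' + 1; have T0 : 0 < T by rewrite ltr_wpDl.
have hT i j : `|u i - v j| <= T by rewrite (le_trans (hT' i j)) // lerDl.
have [S S0 hS] := kernel_bound (fun i j => sinhc (u i - v j)).
have E0 := expR_gt0 (1 : R).
(* K makes m > K, hence 2^(m+1) > K, force both y <= 1 with 4 exp(1) y <= 1,
   and an error below e. *)
pose K := 4 * expR 1 * T * (S + 1) / e + 4 * expR 1 * T + T.
have a1 : 0 <= 4 * expR 1 * T * (S + 1) / e.
  rewrite divr_ge0 ?(ltW e0) // mulr_ge0 ?addr_ge0 // mulr_ge0 ?(ltW T0) //.
  by rewrite mulr_ge0 // ltW.
have a2 : 0 <= 4 * expR 1 * T by rewrite mulr_ge0 ?(ltW T0) // mulr_ge0 // ltW.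
have K0 : 0 <= K by rewrite /K; lra.
have := archi_boundP K0; set m := Num.bound _ => mK.
exists (fun i j => coshprod m.+1 (u i - v j) * cosh ((u i - v j) / 2 ^+ m.+1)).
exists (fun i j => (1 + cosh (u i - v j)) / 2).
split=> [|i j|i j]; [exact: trapezoid_le | | by rewrite subrr normr0 ltW].
set x := u i - v j.
have hm : m%:R <= 2 ^+ m.+1 :> R.
  rewrite -natrX ler_nat; apply: leq_trans (ltnW (ltn_expl m (isT : 1 < 2)%N)) _.
  by rewrite leq_exp2l.
have p0 : 0 < 2 ^+ m.+1 :> R by rewrite exprn_gt0.
have xT : `|x| <= T := hT i j.
have xS : `|sinhc x| <= S := hS i j.
rewrite -(coshprod_sinhc m.+1 x) -mulrBr normrM (ger0_norm (coshprod_ge0 _ _)).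
have : coshprod m.+1 x * sinhc (x / 2 ^+ m.+1) <= S.
  by rewrite coshprod_sinhc (le_trans (ler_norm _)).
move: (coshprod_ge0 m.+1 x); move: (coshprod m.+1 x) => p pp0.
set y := x / 2 ^+ m.+1 => pS.
have yT : `|y| * K <= T.
  rewrite normrM normfV (gtr0_norm p0) mulrAC ler_pdivrMr //.
  by rewrite ler_pM //; lra.
have y0 := normr_ge0 y.
have y1 : `|y| <= 1.
  rewrite -(ler_pM2r T0) mul1r (le_trans _ yT) // ler_wpM2l // /K; lra.
have y2 : 4 * expR 1 * `|y| <= 1.
  rewrite -(ler_pM2r T0) mul1r (le_trans _ yT) // mulrAC mulrC ler_wpM2l //.
  by rewrite /K; lra.
have y3 : 4 * expR 1 * (S + 1) * `|y| <= e.
  rewrite -(ler_pM2r T0) -ler_pdivrMl // (le_trans _ yT) //.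
  rewrite (_ : e^-1 * _ = `|y| * (4 * expR 1 * T * (S + 1) / e)).
    by rewrite ler_wpM2l // /K; lra.
  by field; rewrite gt_eqF.
have := cosh_taylor 2 y1; have := sinhc_taylor 2 y1.
rewrite !big_ord_recl !big_ord0 /= !mul0r !addr0 !mul1r !expr0 !invr1 !mulr1.
move=> c1 c2.
have c0 : `|sinhc y - cosh y| <= 2 * expR 1 * `|y| ^+ 2.
  have -> : sinhc y - cosh y = (sinhc y - 1) - (cosh y - 1) by ring.
  by apply: le_trans (ler_normB _ _) _; lra.
have s0 : 1 / 2 <= sinhc y.
  by move: c1; rewrite ler_norml => /andP[? _]; nra.
have p2 : p <= 2 * S by nra.
apply: le_trans (ler_wpM2l pp0 c0) _.
apply: (@le_trans _ _ (2 * (S + 1) * (2 * expR 1 * `|y| ^+ 2))).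
  by rewrite ler_wpM2r ?mulr_ge0 ?exprn_ge0 ?(ltW E0) //; lra.
rewrite (_ : _ * _ = 4 * expR 1 * (S + 1) * `|y| * `|y|); last by ring.
rewrite -[leRHS]mulr1 ler_pM // mulr_ge0 // mulr_ge0 ?addr_ge0 //.
by rewrite mulr_ge0 ?(ltW E0).
Qed.

Lemma logmean_expR2 x y :
  logmean (expR (2 * x)) (expR (2 * y)) = expR (x + y) * sinhc (x - y).
Proof.
rewrite /logmean !expR_eq0 /= (inj_eq (@expR_inj R)) /sinhc subr_eq0.
rewrite (inj_eq (mulfI (_ : 2 != 0))) ?pnatr_eq0 //.
have e2 z : expR (2 * z) = expR z * expR z by rewrite -expRD; congr expR; ring.
case: eqVneq => [->|xy]; first by rewrite mulr1 e2 expRD.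
rewrite !expRK !e2 opprB !expRD !expRN; field.
by rewrite -mulrBr mulf_eq0 pnatr_eq0 !expR_eq0 subr_eq0 xy.
Qed.

Lemma heronmean_expR2 s x y :
  heronmean s (expR (2 * x)) (expR (2 * y)) =
  expR (x + y) * (s + (1 - s) * cosh (x - y)).
Proof.
have e2 z : expR (2 * z) = expR z * expR z by rewrite -expRD; congr expR; ring.
rewrite /heronmean !e2 mulrACA -expr2 sqrtr_sqr.
rewrite ger0_norm ?mulr_ge0 ?expR_ge0 //.
by rewrite /cosh opprB !expRD !expRN; field; rewrite !expR_eq0.
Qed.

Lemma logmean_le_heron_pos s (l m : 'I_n -> R) Y : 0 <= s <= 1 / 2 ->
  (forall i, 0 < l i) -> (forall j, 0 < m j) ->
  N (schur (fun i j => logmean (l i) (m j)) Y) <=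
  N (schur (fun i j => heronmean s (l i) (m j)) Y).
Proof.
move=> s12 l0 m0; pose u i := ln (l i) / 2; pose v j := ln (m j) / 2.
have lE i : l i = expR (2 * u i).
  by rewrite /u [2 * _]mulrC divfK ?pnatr_eq0 // lnK ?posrE.
have mE j : m j = expR (2 * v j).
  by rewrite /v [2 * _]mulrC divfK ?pnatr_eq0 // lnK ?posrE.
pose Z := schur (fun i j => expR (u i + v j)) Y.
rewrite (_ : schur _ Y = schur (fun i j => sinhc (u i - v j)) Z); last first.
  by rewrite schurM; apply: eq_schur => i j; rewrite lE mE logmean_expR2 mulrC.
rewrite [X in _ <= N X](_ : _ =
  schur (fun i j => s + (1 - s) * cosh (u i - v j)) Z); last first.
  by rewrite schurM; apply: eq_schur => i j; rewrite lE mE heronmean_expR2 mulrC.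
exact: le_trans (sinhc_le_half_heron _ _ _) (heron_le_half _ _ _ s12).
Qed.
End HeronBound.

(** * Continuity at zero eigenvalues *)

Section Boundary.
Variable R : realType.
Local Open Scope classical_set_scope.
Implicit Types a b s : R.

(** Only zero eigenvalues are moved, so kernel entries with both arguments
    positive do not change; the exponential keeps the logarithm explicit. *)
Definition regularize a (k : nat) : R := if a == 0 then expR (- k%:R) else a.

Lemma regularize_gt0 a k : 0 <= a -> 0 < regularize a k.
Proof.
by rewrite /regularize; case: eqVneq => [_ _|a0 a0']; rewrite ?expR_gt0 // lt_def a0.
Qed.

Lemma cvg_regularize a : regularize a k @[k --> \oo] --> a.
Proof.
rewrite /regularize; case: eqVneq => [->|_]; first exact: cvgn_expR.
exact: cvg_cst.
Qed.

Lemma cvg_heronmean s a b :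
  heronmean s (regularize a k) (regularize b k) @[k --> \oo] --> heronmean s a b.
Proof.
have ha := @cvg_regularize a; have hb := @cvg_regularize b.
apply: cvgD; apply: cvgM; try exact: cvg_cst.
  by apply: continuous_cvg; [exact: sqrt_continuous | exact: cvgM].
by apply: cvgM; [exact: cvgD | exact: cvg_cst].
Qed.

Lemma logmeanC a b : logmean a b = logmean b a.
Proof.
rewrite /logmean eq_sym orbC; case: eqVneq => // _.
by case: ifP => // _; rewrite -opprB -[ln a - _]opprB invrN mulrNN.
Qed.

(** For b > 0 the logarithm in the denominator diverges while the numerator stays
    bounded. *)
Lemma cvg_logmean0 b : 0 <= b ->
  logmean (regularize 0 k) (regularize b k) @[k --> \oo] --> (0 : R).
Proof.
move=> b0; have [->|bN0] := eqVneq b 0.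
  rewrite (_ : (fun k => _) = regularize 0); first exact: cvg_regularize.
  by apply/boolp.funext => k; rewrite /logmean eqxx.
rewrite /regularize eqxx (negPf bN0).
have lnb : k%:R + ln b @[k --> \oo] --> +oo.
  apply/cvgryPge => A; near=> k; rewrite -lerBlDr.
  by near: k; exact: nbhs_infty_ger.
have inv0 : (k%:R + ln b)^-1 @[k --> \oo] --> (0 : R).
  apply/gtr0_cvgV0 => //; near=> k; rewrite -ltrBlDr sub0r.
  by near: k; exact: nbhs_infty_gtr.
have lim0 : (b - expR (- k%:R)) * (k%:R + ln b)^-1 @[k --> \oo] --> (0 : R).
  rewrite -[X in _ --> X](mulr0 (b - 0)); apply: cvgM => //.
  by apply: cvgB; [exact: cvg_cst | exact: cvgn_expR].
apply: cvg_trans lim0; apply: near_eq_cvg; near=> k.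
rewrite /logmean expR_eq0 (negPf bN0) /= expRK.
have kb : k%:R + ln b > 0.
  by rewrite -ltrBlDr sub0r; near: k; exact: nbhs_infty_gtr.
case: eqVneq => [eb|_].
  by move: kb; rewrite -eb expRK subrr ltxx.
by rewrite -[in RHS]opprB -opprD invrN mulrNN.
Unshelve. all: by end_near. Qed.

Lemma cvg_logmean a b : 0 <= a -> 0 <= b ->
  logmean (regularize a k) (regularize b k) @[k --> \oo] --> logmean a b.
Proof.
move=> a0 b0; have [->|aN0] := eqVneq a 0.
  rewrite [X in _ --> X](_ : _ = 0); first exact: cvg_logmean0.
  by rewrite /logmean eqxx /=; case: eqVneq.
have [->|bN0] := eqVneq b 0.
  rewrite logmeanC [X in _ --> X](_ : _ = 0).
    under eq_fun do rewrite logmeanC.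
    exact: cvg_logmean0.
  by rewrite /logmean eqxx /=; case: eqVneq.
by rewrite /regularize (negPf aN0) (negPf bN0); exact: cvg_cst.
Qed.
End Boundary.

(** * Sufficiency *)

Section Sufficiency.
Variables (R : realType) (n : nat) (s : R).
Hypothesis s12 : 0 <= s <= 1 / 2.
Local Open Scope complex_scope.
Local Open Scope sesquilinear_scope.
Local Open Scope classical_set_scope.
Variables (N : 'M[R[i]]_n -> R) (hN : unitarily_invariant_norm N).

Lemma logmean_le_heron (l m : 'I_n -> R) (Y : 'M[R[i]]_n) :
  (forall i, 0 <= l i) -> (forall j, 0 <= m j) ->
  N (schur (fun i j => logmean (l i) (m j)) Y) <=
  N (schur (fun i j => heronmean s (l i) (m j)) Y).
Proof.
move=> l0 m0; apply: (schur_closed hN) => e e0.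
have : \forall k \near \oo, forall i j,
    `|logmean (l i) (m j) - logmean (regularize (l i) k) (regularize (m j) k)|
      <= e /\
    `|heronmean s (regularize (l i) k) (regularize (m j) k)
      - heronmean s (l i) (m j)| <= e.
  apply: filter_forall => i; apply: filter_forall => j; near=> k; split.
    by near: k; apply: cvgr_dist_le e0; exact: cvg_logmean.
  by rewrite distrC; near: k; apply: cvgr_dist_le e0; exact: cvg_heronmean.
move=> /filter_ex [k hk].
exists (fun i j => logmean (regularize (l i) k) (regularize (m j) k)).
exists (fun i j => heronmean s (regularize (l i) k) (regularize (m j) k)).
split=> [|i j|i j]; [| by case: (hk i j) | by case: (hk i j)].
by apply: logmean_le_heron_pos => // i; exact: regularize_gt0.
Unshelve. all: by end_near. Qed.

(** The i-th eigenvalue is the value of the Hermitian form at the i-th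
    eigenvector, the i-th column of the adjoint of [spectralmx S]. *)
Lemma spectral_diag_ge0 (S : 'M[R[i]]_n) i :
  psdmx S -> 0 <= complex.Re (spectral_diag S 0 i).
Proof.
move=> Spsd; have := psdmx_spectralE Spsd; rewrite trmxCK => SE.
have [_ /(_ ((spectralmx S)^t* *m delta_mx i 0))] := Spsd.
set P := spectralmx S in SE *; have /unitarymxP PP : P \is unitarymx.
  exact: spectral_unitarymx.
rewrite [X in _ *m X *m _]SE trmx_mul map_mxM /= trmxCK !mulmxA.
rewrite -(mulmxA _ P) PP mulmx1 -(mulmxA _ P) PP mulmx1.
by rewrite trmx_delta map_delta_mx -rowE -colE !mxE eqxx mulr1n ler0c.
Qed.

Lemma meanmx_schur (M : R -> R -> R) (S T X : 'M[R[i]]_n) :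
  N (meanmx M S T X) =
  N (schur (fun i j => M (complex.Re (spectral_diag S 0 i))
                         (complex.Re (spectral_diag T 0 j)))
      (spectralmx S *m X *m (spectralmx T)^t*)).
Proof.
rewrite /meanmx (uinorm_unitary hN) ?trmxC_unitary ?spectral_unitarymx //.
by congr N; apply/matrixP => i j; rewrite !mxE trmxCK.
Qed.

Lemma sufficiency (S T X : 'M[R[i]]_n) : psdmx S -> psdmx T ->
  N (meanmx (@logmean R) S T X) <= N (meanmx (heronmean s) S T X).
Proof.
move=> Sp Tp; rewrite !meanmx_schur.
by apply: logmean_le_heron => i; exact: spectral_diag_ge0.
Qed.

End Sufficiency.

(** * The operator norm and positive kernels *)

Section OperatorNorm.
Variables (R : realType) (n : nat).
Local Open Scope complex_scope.
Local Open Scope sesquilinear_scope.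
Local Open Scope classical_set_scope.
Implicit Types (x y : 'cV[R[i]]_n) (X Y U V : 'M[R[i]]_n).
Local Notation normc := Normc.normc.

Definition sqnorm x : R := \sum_i normc (x i 0) ^+ 2.

Definition form X x y : R[i] := (x^t* *m X *m y) 0 0.

(** Unit balls instead of unit spheres make the set nonempty in every
    dimension. *)
Definition opnorm X : R :=
  sup [set r | exists x y, [/\ sqnorm x <= 1, sqnorm y <= 1
                            & r = normc (form X x y)]].

Lemma normc_ge0 (z : R[i]) : 0 <= normc z.
Proof. by case: z => a b; exact: sqrtr_ge0. Qed.

Lemma normc_sqr (z : R[i]) : z^*%R * z = (normc z ^+ 2)%:C.
Proof.
case: z => a b; rewrite /= sqr_sqrtr ?addr_ge0 ?sqr_ge0 //.
by apply/eqP; rewrite eq_complex /= !mulNr opprK -!expr2 eqxx /= mulrC subrr.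
Qed.

Lemma normc_conj (z : R[i]) : normc z^*%R = normc z.
Proof. by case: z => a b; rewrite /= sqrrN. Qed.

Lemma normc_real (a : R) : normc a%:C = `|a|.
Proof. by rewrite /= expr0n addr0 sqrtr_sqr. Qed.

Lemma normc_sum (I : Type) (r : seq I) (F : I -> R[i]) :
  normc (\sum_(i <- r) F i) <= \sum_(i <- r) normc (F i).
Proof.
elim: r => [|a r IH]; first by rewrite !big_nil Normc.normc0.
by rewrite !big_cons; apply: le_trans (le_normcD _ _) _; rewrite lerD2l.
Qed.

Lemma sqnormE x : (x^t* *m x) 0 0 = (sqnorm x)%:C.
Proof.
by rewrite !mxE rmorph_sum; apply: eq_bigr => i _; rewrite !mxE normc_sqr.
Qed.

Lemma sqnorm_unitary U x : U \is unitarymx -> sqnorm (U *m x) = sqnorm x.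
Proof.
move=> /unitarymxP/mulmx1C uU; apply: (@complexI R); rewrite -!sqnormE.
by rewrite trmx_mul map_mxM !mulmxA -(mulmxA _ _ U) uU mulmx1.
Qed.

Lemma sqnorm_coord x i : sqnorm x <= 1 -> normc (x i 0) <= 1.
Proof.
move=> x1; rewrite -(@ler_pXn2r _ 2) ?nnegrE ?normc_ge0 ?expr1n //.
apply: le_trans x1; rewrite /sqnorm (bigD1 i) //= lerDl sumr_ge0 // => j _.
exact: sqr_ge0.
Qed.

Lemma sqnorm0 : sqnorm 0 <= 1.
Proof.
by rewrite /sqnorm big1 // => i _; rewrite mxE Normc.normc0 expr0n.
Qed.

Lemma formE X x y : form X x y = \sum_j (\sum_i (x i 0)^*%R * X i j) * y j 0.
Proof.
rewrite /form mxE; apply: eq_bigr => j _; rewrite mxE; congr (_ * _).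
by apply: eq_bigr => i _; rewrite !mxE.
Qed.

Lemma opnorm_has_ubound X :
  has_ubound [set r | exists x y, [/\ sqnorm x <= 1, sqnorm y <= 1
                            & r = normc (form X x y)]].
Proof.
exists (\sum_j \sum_i normc (X i j)) => r [x [y [x1 y1 ->]]]; rewrite formE.
apply: le_trans (normc_sum _ _) _; apply: ler_sum => j _.
rewrite Normc.normcM -[leRHS]mulr1 ler_pM ?normc_ge0 ?sqnorm_coord //.
apply: le_trans (normc_sum _ _) _; apply: ler_sum => i _.
by rewrite Normc.normcM normc_conj ler_piMl ?normc_ge0 ?sqnorm_coord.
Qed.

Lemma opnorm_ub X x y : sqnorm x <= 1 -> sqnorm y <= 1 ->
  normc (form X x y) <= opnorm X.
Proof.
by move=> x1 y1; apply: ub_le_sup; [exact: opnorm_has_ubound | exists x, y].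
Qed.

Lemma opnorm_le X c :
  (forall x y, sqnorm x <= 1 -> sqnorm y <= 1 -> normc (form X x y) <= c) ->
  opnorm X <= c.
Proof.
move=> H; apply: ge_sup; last by move=> r [x [y [x1 y1 ->]]]; exact: H.
by exists (normc (form X 0 0)), 0, 0; split; rewrite ?sqnorm0.
Qed.

Lemma formZ a X x y : form (a *: X) x y = a * form X x y.
Proof. by rewrite /form -scalemxAr -scalemxAl mxE. Qed.

Lemma formD X Y x y : form (X + Y) x y = form X x y + form Y x y.
Proof. by rewrite /form mulmxDr mulmxDl mxE. Qed.

Lemma form_mul U X V x y : form (U *m X *m V) x y = form X (U^t* *m x) (V *m y).
Proof. by rewrite /form trmx_mul map_mxM /= trmxCK !mulmxA. Qed.

Lemma opnorm_ge0 X : 0 <= opnorm X.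
Proof.
by apply: le_trans (opnorm_ub X sqnorm0 sqnorm0); exact: normc_ge0.
Qed.

Lemma opnorm_leZ a X : opnorm (a *: X) <= normc a * opnorm X.
Proof.
apply: opnorm_le => x y x1 y1; rewrite formZ Normc.normcM.
by rewrite ler_wpM2l ?normc_ge0 ?opnorm_ub.
Qed.

Lemma opnorm_leU U V X : U \is unitarymx -> V \is unitarymx ->
  opnorm (U *m X *m V) <= opnorm X.
Proof.
move=> uU uV; apply: opnorm_le => x y x1 y1; rewrite form_mul.
rewrite -trmxC_unitary in uU.
by apply: opnorm_ub; rewrite (sqnorm_unitary _ uU, sqnorm_unitary _ uV).
Qed.

Lemma opnorm_uinvariant : unitarily_invariant_norm opnorm.
Proof.
split; first exact: opnorm_ge0.
- move=> X X0; apply/matrixP => i j; rewrite mxE.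
  have sq1 k : sqnorm (delta_mx k 0) <= 1.
    rewrite /sqnorm (bigD1 k) //= big1 => [|l lk]; rewrite !mxE ?eqxx.
      by rewrite addr0 Normc.normc1 expr1n.
    by rewrite (negPf lk) Normc.normc0 expr0n.
  have := opnorm_ub X (sq1 i) (sq1 j); rewrite X0 /form trmx_delta map_delta_mx.
  rewrite -rowE -colE !mxE => Xij.
  by apply: Normc.eq0_normc; apply/le_anti; rewrite Xij normc_ge0.
- move=> a X; apply/le_anti; rewrite opnorm_leZ /=.
  have [->|a0] := eqVneq a 0; first by rewrite Normc.normc0 mul0r opnorm_ge0.
  have na0 : 0 < normc a.
    by rewrite lt_def normc_ge0 andbT; apply: contra_neq a0 => /Normc.eq0_normc.
  rewrite -ler_pdivlMl // -Normc.normcV; apply: le_trans (opnorm_leZ _ _).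
  by rewrite scalerA (mulVf a0) scale1r.
- move=> X Y; apply: opnorm_le => x y x1 y1; rewrite formD.
  by apply: le_trans (le_normcD _ _) _; rewrite lerD ?opnorm_ub.
- move=> U V X uU uV; apply: le_anti; apply/andP; split.
    exact: (opnorm_leU X uU uV).
  have {1}-> : X = U^t* *m (U *m X *m V) *m V^t*.
    rewrite !mulmxA -(mulmxA _ V) (unitarymxP uV) mulmx1.
    by rewrite (mulmx1C (unitarymxP uU)) mul1mx.
  rewrite -trmxC_unitary in uU; rewrite -trmxC_unitary in uV.
  exact: opnorm_leU uU uV.
Qed.

Lemma opnorm_unitary_le1 U : U \is unitarymx -> opnorm U <= 1.
Proof.
move=> uU; have u1 : (1%:M : 'M[R[i]]_n) \is unitarymx.
  by apply/unitarymxP; rewrite trmx1 map_mx1 mulmx1.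
rewrite -[U]mulmx1 -[U *m _]mulmx1 (uinorm_unitary opnorm_uinvariant _ uU u1).
apply: opnorm_le => x y x1 y1; rewrite /form mulmx1 mxE.
apply: le_trans (normc_sum _ _) _.
apply: (@le_trans _ _ (\sum_i (normc (x i 0) ^+ 2 + normc (y i 0) ^+ 2) / 2)).
  apply: ler_sum => i _; rewrite !mxE Normc.normcM normc_conj.
  by have := sqr_ge0 (normc (x i 0) - normc (y i 0)); lra.
rewrite -mulr_suml big_split /= -/(sqnorm x) -/(sqnorm y); lra.
Qed.

(** Let J be the all-ones matrix. W = (2 / n) J - 1 is a reflection, so it has
    norm 1, and the multiplier sends it to (2 / n) k - 1 because k has unit
    diagonal. At a unit vector the quadratic form of the latter must not fall
    below -1, so that of k is nonnegative. *)
Lemma contractive_multiplier_psd (k : 'I_n -> 'I_n -> R) (v : 'I_n -> R) :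
  (0 < n)%N -> (forall i, k i i = 1) ->
  (forall Y, opnorm (schur k Y) <= opnorm Y) ->
  0 <= \sum_i \sum_j v i * v j * k i j.
Proof.
move=> n0 k1 hk; set Q := \sum_i _.
pose W : 'M[R[i]]_n := \matrix_(i, j) (2 / n%:R - (i == j)%:R)%:C.
have uW : W \is unitarymx.
  apply/unitarymxP/matrixP => i j; rewrite !mxE.
  transitivity ((\sum_a (2 / n%:R - (i == a)%:R) * (2 / n%:R - (j == a)%:R))%:C : R[i]).
    rewrite rmorph_sum; apply: eq_bigr => a _; rewrite !mxE rmorphM.
    by congr (_ * _); apply/eqP; rewrite eq_complex /= oppr0 !eqxx.
  rewrite -(rmorph_nat (real_complex R)); congr (_%:C).
  under eq_bigr do rewrite mulrBl !mulrBr.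
  rewrite !sumrB sumr_const card_ord -!mulr_sumr -!mulr_suml.
  have sd (a : 'I_n) : \sum_b (a == b)%:R = 1 :> R.
    by rewrite (bigD1 a) //= eqxx big1 ?addr0 // => b ab; rewrite eq_sym (negPf ab).
  rewrite !sd (bigD1 i) //= eqxx mul1r big1 => [|b bi]; last first.
    by rewrite eq_sym (negPf bi) mul0r.
  rewrite addr0 eq_sym; set d := (i == j)%:R; rewrite -[_ *+ n]mulr_natl /= mulr1n.
  by field; rewrite pnatr_eq0 -lt0n.
pose S := \sum_i v i ^+ 2.
have S0 : 0 <= S by apply: sumr_ge0 => i _; exact: sqr_ge0.
have [S00|SN0] := eqVneq S 0.
  rewrite /Q big1 // => i _; rewrite big1 // => j _.
  have /eqP : v i ^+ 2 = 0.
    move: S00 => /eqP; rewrite psumr_eq0 => [/allP/(_ i)|a _]; last exact: sqr_ge0.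
    by rewrite mem_index_enum => /(_ isT)/eqP.
  by rewrite sqrf_eq0 => /eqP ->; rewrite !mul0r.
have Sp : 0 < S by rewrite lt_def SN0.
pose c := (Num.sqrt S)^-1.
have c2 : c ^+ 2 = S^-1 by rewrite exprVn sqr_sqrtr.
pose x : 'cV[R[i]]_n := \col_i (c * v i)%:C.
have x1 : sqnorm x <= 1.
  rewrite /sqnorm.
  under eq_bigr do rewrite mxE normc_real real_normK ?num_real // exprMn c2.
  by rewrite -mulr_sumr mulVf.
have fE : form (schur k W) x x = (2 / n%:R * Q / S - 1)%:C.
  rewrite formE.
  transitivity ((\sum_j (\sum_i c * v i * (k i j * (2 / n%:R - (i == j)%:R)))
                 * (c * v j))%:C : R[i]).
    rewrite rmorph_sum; apply: eq_bigr => j _.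
    rewrite [in RHS]rmorphM [x j 0]mxE; congr (_ * _).
    rewrite rmorph_sum; apply: eq_bigr => i _; rewrite !mxE !rmorphM.
    by congr (_ * _); apply/eqP; rewrite eq_complex /= oppr0 !eqxx.
  congr (_%:C).
  transitivity (\sum_j (\sum_i 2 / n%:R / S * (v i * v j * k i j) - v j ^+ 2 / S)).
    apply: eq_bigr => j _; rewrite mulr_suml (bigD1 j) //= [in RHS](bigD1 j) //=.
    rewrite eqxx k1 [RHS]addrAC; congr (_ + _).
      by rewrite -c2 /= mulr1n; ring.
    by apply: eq_bigr => i /negPf ->; rewrite subr0 -c2; ring.
  rewrite sumrB -mulr_suml -/S divff //; congr (_ - 1).
  rewrite exchange_big /=.
  under eq_bigr do rewrite -mulr_sumr.
  by rewrite -mulr_sumr -/Q mulrAC.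
have := opnorm_ub (schur k W) x1 x1.
have := le_trans (hk W) (opnorm_unitary_le1 uW) => h1 /le_trans/(_ h1).
rewrite fE normc_real ler_norml => /andP[h2 _].
have nz : 0 < 2 / n%:R / S :> R by rewrite !divr_gt0 // ltr0n.
rewrite -(pmulr_rge0 _ nz); move: h2; rewrite -[2 / _ * Q / S]mulrAC; lra.
Qed.

End OperatorNorm.

(** * Sign of the Taylor coefficients of a positive definite quotient *)

Section HeronQuotient.
Variable R : realType.
Implicit Types (s t h : R) (f e : nat -> R).

(** The power series with exponential coefficients e is invertible because its
    constant term is 1; the equation determines a recursively. *)
Lemma binomial_convolution_inverse e f : e 0%N = 1 -> exists a : nat -> R,
  forall k, \sum_(p < k.+1) 'C(k, p)%:R * a p * e (k - p)%N = f k.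
Proof.
move=> e0; pose fix solve k : seq R := if k is k'.+1 then
  rcons (solve k')
    (f k' - \sum_(p < k') 'C(k', p)%:R * (solve k')`_p * e (k' - p)%N)
  else [::].
have sz k : size (solve k) = k by elim: k => //= k IH; rewrite size_rcons IH.
pose a p := (solve p.+1)`_p.
have solveE k p : (p < k)%N -> (solve k)`_p = a p.
  elim: k => // k IH; rewrite ltnS leq_eqVlt => /orP[/eqP -> //|pk].
  by rewrite /= nth_rcons sz pk IH.
exists a => k; rewrite big_ord_recr /= subnn e0 binn mul1r mulr1.
rewrite [a k](_ : _ = f k - \sum_(p < k) 'C(k, p)%:R * a p * e (k - p)%N).
  by rewrite subrKC.
rewrite /a [solve k.+1]/= nth_rcons sz ltnn eqxx; congr (_ - _).
by apply: eq_bigr => p _; rewrite (solveE k).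
Qed.

Lemma poly_small (q : {poly R}) m : (forall i, (i < m)%N -> q`_i = 0) ->
  exists2 B : R, 0 <= B & forall t, `|t| <= 1 -> `|q.[t]| <= B * `|t| ^+ m.
Proof.
move=> q0; exists (\sum_(i < size q) `|q`_i|); first exact: sumr_ge0.
move=> t t1; rewrite horner_coef mulr_suml; apply: le_trans (ler_norm_sum _ _ _) _.
apply: ler_sum => i _; rewrite normrM normrX.
have [/q0 ->|mi] := ltnP i m; first by rewrite normr0 !mul0r.
by rewrite ler_wpM2l // ler_wiXn2l.
Qed.

Definition heronquot s t : R := sinhc t / (s + (1 - s) * cosh t).

(** The exponential Taylor coefficients at 0 of s + (1 - s) cosh. *)
Definition heron_coef s (q : nat) : R := s * (q == 0)%:R + (1 - s) * (~~ odd q)%:R.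

Lemma fact_neq0 k : k`!%:R != 0 :> R.
Proof. by rewrite pnatr_eq0 -lt0n fact_gt0. Qed.

(** The hypothesis says that the formal series of a, times that of
    s + (1 - s) cosh, is that of sinhc. Truncating all three at degree n leaves a
    polynomial without terms of degree at most n, and dividing by
    s + (1 - s) cosh >= 1 does not increase the error. *)
Lemma heronquot_taylor s (a : nat -> R) n : 0 <= s <= 1 ->
  (forall k, \sum_(p < k.+1) 'C(k, p)%:R * a p * heron_coef s (k - p) =
     (~~ odd k)%:R / k.+1%:R) ->
  exists2 C : R, 0 <= C & forall t, `|t| <= 1 ->
    `|heronquot s t - \sum_(p < n.+1) a p / p`!%:R * t ^+ p| <= C * `|t| ^+ n.+1.
Proof.
move=> /andP[s0 s1] aE.
pose pD := \poly_(q < n.+1) (heron_coef s q / q`!%:R).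
pose pP := \poly_(p < n.+1) (a p / p`!%:R).
pose pS := \poly_(k < n.+1) ((~~ odd k)%:R * (k.+1`!%:R)^-1 : R).
have [|B B0 hB] := @poly_small (pS - pD * pP) n.+1.
  move=> k kn; rewrite coefB coefMr coef_poly kn.
  apply/eqP; rewrite subr_eq0; apply/eqP.
  have -> : (~~ odd k)%:R * (k.+1`!%:R)^-1 = (~~ odd k)%:R / k.+1%:R / k`!%:R :> R.
    by rewrite factS natrM invfM mulrA.
  rewrite -aE mulr_suml; apply: eq_bigr => p _.
  have pk : (p <= k)%N by rewrite -ltnS.
  rewrite !coef_poly (leq_ltn_trans (leq_subr _ _) kn) (leq_ltn_trans pk kn).
  rewrite -(bin_fact pk) !natrM; field.
  by rewrite !fact_neq0 pnatr_eq0 -lt0n bin_gt0.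
pose A := \sum_(p < n.+1) `|a p / p`!%:R|.
have A0 : 0 <= A by exact: sumr_ge0.
have E0 := expR_ge0 (1 : R).
exists (B + expR 1 + (1 - s) * expR 1 * A).
  by rewrite !addr_ge0 // mulr_ge0 // mulr_ge0 // subr_ge0.
move=> t t1.
have -> : \sum_(p < n.+1) a p / p`!%:R * t ^+ p = pP.[t] by rewrite horner_poly.
have PA : `|pP.[t]| <= A.
  rewrite horner_poly; apply: le_trans (ler_norm_sum _ _ _) _.
  by apply: ler_sum => p _; rewrite normrM ler_piMr // normrX exprn_ile1.
have D1 : 1 <= s + (1 - s) * cosh t by have := cosh_ge1 t; nra.
have hS : `|sinhc t - pS.[t]| <= expR 1 * `|t| ^+ n.+1.
  by rewrite horner_poly; exact: sinhc_taylor.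
have hD : `|s + (1 - s) * cosh t - pD.[t]| <= (1 - s) * expR 1 * `|t| ^+ n.+1.
  have -> : s + (1 - s) * cosh t - pD.[t] = (1 - s) *
     (cosh t - \sum_(i < n.+1) ((~~ odd i)%:R * (i`!%:R)^-1) * t ^+ i).
    rewrite horner_poly mulrBr mulr_sumr.
    rewrite [X in _ - X](_ : _ = s + \sum_(i < n.+1) (1 - s) *
      ((~~ odd i)%:R * (i`!%:R)^-1 * t ^+ i)); first by ring.
    rewrite /heron_coef [in LHS](eq_bigr (fun i : 'I_n.+1 =>
      s * (i == 0 :> nat)%:R / i`!%:R * t ^+ i +
      (1 - s) * ((~~ odd i)%:R * (i`!%:R)^-1 * t ^+ i))); last first.
      by move=> i _; rewrite !mulrDl !mulrA.
    rewrite big_split /=; congr (_ + _); rewrite big_ord_recl big1 => [|i _].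
      by rewrite /= fact0 expr0 invr1 !mulr1 addr0.
    by rewrite mulr0 !mul0r.
  by rewrite normrM ger0_norm ?subr_ge0 // -mulrA ler_wpM2l ?subr_ge0 // cosh_taylor.
have D0 : 0 < s + (1 - s) * cosh t by lra.
rewrite /heronquot; set D := s + _ in D1 hD D0 *.
have -> : sinhc t / D - pP.[t] =
   ((pS - pD * pP).[t] + (sinhc t - pS.[t]) - (D - pD.[t]) * pP.[t]) / D.
  by rewrite hornerD hornerN hornerM; field; rewrite gt_eqF.
rewrite normrM normfV (gtr0_norm D0) ler_pdivrMr //.
apply: (@le_trans _ _ ((B + expR 1 + (1 - s) * expR 1 * A) * `|t| ^+ n.+1)); last first.
  rewrite ler_peMr // mulr_ge0 ?exprn_ge0 //.
  by rewrite !addr_ge0 // mulr_ge0 // mulr_ge0 // subr_ge0.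
apply: le_trans (ler_normB _ _) _; rewrite [leRHS]mulrDl [X in _ <= X + _]mulrDl lerD //.
  by apply: le_trans (ler_normD _ _) _; rewrite lerD // hB.
by rewrite normrM [leRHS]mulrAC ler_pM.
Qed.

(** The Vandermonde matrix of distinct points is invertible; the solution v is a
    divided difference, which annihilates all powers below m. *)
Lemma moment_functional m (x : 'I_m.+1 -> R) : injective x ->
  exists v : 'I_m.+1 -> R, forall a, (a <= m)%N ->
    \sum_i v i * x i ^+ a = (a == m)%:R.
Proof.
move=> xI; pose V := Vandermonde m.+1 (\row_i x i).
have Vu : V \in unitmx.
  rewrite unitmxE unitfE det_Vandermonde prodf_seq_neq0; apply/allP => i _ /=.
  rewrite prodf_seq_neq0; apply/allP => j _ /=; apply/implyP => ij.
  by rewrite !mxE subr_eq0 (inj_eq xI) gt_eqF.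
pose v := invmx V *m delta_mx ord_max (0 : 'I_1).
exists (fun i => v i 0) => a am.
have /matrixP/(_ (inord a) 0) : V *m v = delta_mx ord_max 0.
  by rewrite mulKVmx.
rewrite !mxE eqxx andbT -val_eqE /= inordK // => <-.
by apply: eq_bigr => i _; rewrite !mxE inordK // mulrC.
Qed.

Lemma leading_coef_ge0 (b C h0 : R) m : 0 <= C -> 0 < h0 ->
  (forall h, 0 < h <= h0 -> 0 <= b * h ^+ m + C * h ^+ m.+1) -> 0 <= b.
Proof.
move=> C0 h00 H; rewrite leNgt; apply/negP => b0.
pose h := Num.min h0 (- b / (2 * (C + 1))).
have C1 : 0 < 2 * (C + 1) by lra.
have hp : 0 < h by rewrite lt_min h00 divr_gt0 //; lra.
have hb : h * (2 * (C + 1)) <= - b by rewrite -ler_pdivlMr // ge_min lexx orbT.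
have := H h; rewrite hp ge_min lexx => /(_ isT).
rewrite exprS mulrA -mulrDl pmulr_lge0 ?exprn_gt0 //; nra.
Qed.

(** Evaluate the quadratic form at the points h x_i with the weights v of
    [moment_functional]. In the expansion of (x_i - x_j)^p every term contains a
    power below m of x_i or of x_j when p < 2 m, and for p = 2 m only the middle
    term survives, with sign (-1)^m. So the form is a positive multiple of
    (-1)^m a_(2m) h^(2m), up to a term of order h^(2m+1). *)
Lemma psd_taylor_sign s (a : nat -> R) m : 0 <= s <= 1 ->
  (forall k, \sum_(p < k.+1) 'C(k, p)%:R * a p * heron_coef s (k - p) =
     (~~ odd k)%:R / k.+1%:R) ->
  (forall n (u v : 'I_n -> R),
     0 <= \sum_i \sum_j v i * v j * heronquot s (u i - u j)) ->
  0 <= (-1) ^+ m * a (m + m)%N.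
Proof.
move=> s01 aE psd.
have [C C0 hC] := heronquot_taylor (m + m) s01 aE.
(* Points in [0, 1], so that |h x_i - h x_j| <= h <= 1. *)
pose x (i : 'I_m.+1) : R := i%:R / m.+1%:R.
have xI : injective x.
  move=> i j /(mulIf _) h; apply/val_inj/eqP; rewrite -(eqr_nat R).
  by apply/eqP/h; rewrite invr_eq0 pnatr_eq0.
have x1 i j : `|x i - x j| <= 1.
  have xb k : 0 <= x k <= 1.
    rewrite divr_ge0 //= ler_pdivrMr ?ltr0n // mul1r ler_nat ltnW //.
  by have := xb i; have := xb j; rewrite ler_norml; lra.
have [v vE] := moment_functional xI.
have moment p : (p <= m + m)%N ->
  \sum_i \sum_j v i * v j * (x i - x j) ^+ p =
  (p == m + m)%:R * ((-1) ^+ m * 'C(m + m, m)%:R).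
  move=> pm.
  transitivity (\sum_(b < p.+1) (-1) ^+ b * 'C(p, b)%:R *
     ((\sum_i v i * x i ^+ (p - b)) * \sum_j v j * x j ^+ b)).
    under eq_bigr => i _ do under eq_bigr => j _ do rewrite exprBn mulr_sumr.
    under eq_bigr => i _ do rewrite exchange_big.
    rewrite exchange_big; apply: eq_bigr => b _ /=.
    rewrite mulr_suml mulr_sumr; apply: eq_bigr => i _.
    rewrite !mulr_sumr; apply: eq_bigr => j _.
    by rewrite -mulr_natr; ring.
  have [pE|pN] := eqVneq p (m + m)%N.
    rewrite pE mul1r (bigD1 (inord m : 'I_(m + m).+1)) //= inordK ?ltnS ?leq_addr //.
    rewrite addnK !vE // eqxx !mulr1 big1 ?addr0 // => b bm.
    have bmN : (b : nat) != m
      by apply: contra_neq bm => bm; apply: val_inj; rewrite /= inordK // ltnS leq_addr.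
    case: (ltnP b m) => [blt|bge].
      by rewrite (vE b (ltnW blt)) (negPf bmN) !mulr0.
    have mb : (m + m - b < m)%N by have := ltn_ord b; lia.
    by rewrite (vE _ (ltnW mb)) ltn_eqF // mul0r mulr0.
  rewrite mul0r big1 // => b _.
  case: (ltnP b m) => [blt|bge].
    by rewrite (vE b (ltnW blt)) ltn_eqF // !mulr0.
  have mb : (p - b < m)%N by have := ltn_ord b; lia.
  by rewrite (vE _ (ltnW mb)) ltn_eqF // mul0r mulr0.
pose B := \sum_i \sum_j `|v i * v j| * C.
have B0 : 0 <= B by do 2! apply: sumr_ge0 => ? _; rewrite mulr_ge0.
pose g := a (m + m)%N / (m + m)`!%:R * ((-1) ^+ m * 'C(m + m, m)%:R).
suff g0 : 0 <= g.
  have pos : 0 < 'C(m + m, m)%:R / (m + m)`!%:R :> R.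
    by rewrite divr_gt0 ?ltr0n ?fact_gt0 // bin_gt0 leq_addr.
  by rewrite -(pmulr_lge0 _ pos) (_ : _ * _ = g) // /g; ring.
apply: (@leading_coef_ge0 g B 1 (m + m)) => // h /andP[h0 h1].
apply: le_trans (psd _ (fun i => h * x i) v) _.
have hx i j : `|h * x i - h * x j| <= h.
  by rewrite -mulrBr normrM (gtr0_norm h0) ler_piMr // ltW.
have -> : g * h ^+ (m + m) = \sum_i \sum_j v i * v j *
   (\sum_(p < (m + m).+1) a p / p`!%:R * (h * x i - h * x j) ^+ p).
  under eq_bigr => i _ do under eq_bigr => j _ do rewrite mulr_sumr.
  under eq_bigr => i _ do rewrite exchange_big.
  rewrite exchange_big /=.
  transitivity (\sum_(p < (m + m).+1) a p / p`!%:R * h ^+ p *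
     \sum_i \sum_j v i * v j * (x i - x j) ^+ p).
    rewrite big_ord_recr /= moment // eqxx mul1r big1 => [|p _].
      by rewrite add0r /g; ring.
    by rewrite moment ?ltn_eqF ?mul0r ?mulr0 // ltnW.
  apply: eq_bigr => p _; rewrite mulr_sumr; apply: eq_bigr => i _.
  rewrite mulr_sumr; apply: eq_bigr => j _.
  by rewrite -mulrBr exprMn; ring.
rewrite /B mulr_suml -big_split /=; apply: ler_sum => i _.
rewrite mulr_suml -big_split /=; apply: ler_sum => j _.
rewrite addrC -lerBlDr -mulrBr; apply: le_trans (ler_norm _) _.
rewrite normrM -mulrA ler_wpM2l //.
apply: le_trans (hC _ (le_trans (hx i j) h1)) _.
by rewrite ler_wpM2l // lerXn2r // ?nnegrE // ltW.
Qed.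

End HeronQuotient.

(** * No nonnegative moments beyond one half *)

Section NoNonnegativeMoments.
Variable R : realType.
Implicit Types (s t th : R) (f : nat -> R).

(** The real and imaginary parts of the k-th power of the imaginary unit. *)
Definition re_ipow (k : nat) : R := (~~ odd k)%:R * (-1) ^+ k./2.
Definition im_ipow (k : nat) : R := (odd k)%:R * (-1) ^+ k./2.

Lemma re_ipowS k : re_ipow k.+1 = - im_ipow k.
Proof.
rewrite /re_ipow /im_ipow /= negbK uphalf_half; case: odd => /=.
  by rewrite add1n exprS !mulN1r; ring.
by rewrite !mul0r oppr0.
Qed.

Lemma im_ipowS k : im_ipow k.+1 = re_ipow k.
Proof.
rewrite /re_ipow /im_ipow /= uphalf_half; case: odd => /=; first by rewrite !mul0r.
by rewrite add0n.
Qed.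

(** This is (c + d x)^m with each power x^j replaced by f j, that is, the value of
    an umbral expectation at (c + d x)^m. *)
Definition binsum (c d : R) (m : nat) f : R :=
  \sum_(j < m.+1) 'C(m, j)%:R * c ^+ (m - j) * d ^+ j * f j.

Lemma binsumS c d m f :
  binsum c d m.+1 f = c * binsum c d m f + d * binsum c d m (f \o S).
Proof.
rewrite /binsum big_ord_recl.
under eq_bigr => j _ do rewrite lift0 binS natrD subSS !mulrDl.
rewrite big_split /= addrA; congr (_ + _); last first.
  rewrite mulr_sumr; apply: eq_bigr => j _.
  by rewrite exprS; ring.
rewrite big_ord_recr /= (bin_small (ltnSn m)) !mul0r addr0 [in RHS]big_ord_recl.
rewrite mulrDr mulr_sumr !bin0 !subn0; congr (_ + _).
  by rewrite exprS; ring.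
apply: eq_bigr => j _; rewrite lift0 -(subnSK (ltn_ord j)) exprS; ring.
Qed.

Lemma eq_binsum c d m f g : f =1 g -> binsum c d m f = binsum c d m g.
Proof. by move=> fg; apply: eq_bigr => j _; rewrite fg. Qed.

(** De Moivre's formula (cos th + i sin th)^m = cos (m th) + i sin (m th), split
    into its real and imaginary parts. *)
Lemma de_moivre th m :
  binsum (cos th) (sin th) m re_ipow = cos (m%:R * th) /\
  binsum (cos th) (sin th) m im_ipow = sin (m%:R * th).
Proof.
elim: m => [|m [IHc IHs]].
  rewrite /binsum !big_ord1 /re_ipow /im_ipow bin0 subn0 /= mul0r cos0 sin0.
  by split; ring.
rewrite !binsumS (eq_binsum _ _ _ (re_ipowS : re_ipow \o S =1 _)).
rewrite (eq_binsum _ _ _ (im_ipowS : im_ipow \o S =1 _)) IHc IHs.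
have -> : binsum (cos th) (sin th) m (fun k => - im_ipow k) = - sin (m%:R * th).
  by rewrite -IHs /binsum -sumrN; apply: eq_bigr => j _; rewrite mulrN.
rewrite -[m.+1%:R]natr1 mulrDl mul1r cosD sinD; split; ring.
Qed.

(** Umbrally, the sum of independent x and y with moments a and e: expand
    (c + d (x + y))^n first in powers of d x. *)
Lemma binsum_convolution c d n (a e : nat -> R) :
  binsum c d n (fun k => \sum_(p < k.+1) 'C(k, p)%:R * a p * e (k - p)%N) =
  \sum_(p < n.+1) 'C(n, p)%:R * d ^+ p * a p * binsum c d (n - p) e.
Proof.
rewrite /binsum.
transitivity (\sum_(0 <= p < n.+1) \sum_(0 <= k < n.+1)
   'C(n, k)%:R * c ^+ (n - k) * d ^+ k * ('C(k, p)%:R * a p * e (k - p)%N)).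
  rewrite exchange_big /= big_mkord; apply: eq_bigr => k _.
  rewrite mulr_sumr (big_cat_nat (n := k.+1)) //= big_mkord.
  rewrite [X in _ + X]big1_seq ?addr0 // => p.
  rewrite mem_index_iota => /andP[_ /andP[kp _]].
  by rewrite (bin_small kp) !mul0r mulr0.
rewrite big_mkord; apply: eq_bigr => p _.
have pn : (p <= n)%N by rewrite -ltnS.
rewrite (big_cat_nat (n := p)) ?(leqW pn) //=.
rewrite [X in X + _]big1_seq ?add0r => [|k]; last first.
  rewrite mem_index_iota => /andP[_ /andP[_ kp]].
  by rewrite (bin_small kp) !mul0r mulr0.
rewrite -{1}[p : nat]add0n big_addn subSn // big_mkord mulr_sumr.
apply: eq_bigr => q _; have qn : (q <= n - p)%N by rewrite -ltnS.
have qpn : (q + p <= n)%N by lia.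
rewrite addnK exprD (_ : n - (q + p) = n - p - q)%N; last by lia.
have : 'C(n, q + p)%:R * 'C(q + p, p)%:R = 'C(n, p)%:R * 'C(n - p, q)%:R :> R.
  rewrite -!natrM; congr _%:R; apply/eqP.
  rewrite -(eqn_pmul2r (fact_gt0 p)) -(eqn_pmul2r (fact_gt0 q)).
  rewrite -(eqn_pmul2r (fact_gt0 (n - p - q))); apply/eqP.
  have := bin_fact qpn; have := bin_fact pn; have := bin_fact qn.
  have := bin_fact (leq_addl q p); rewrite addnK.
  rewrite (_ : n - (q + p) = n - p - q)%N; last by lia.
  by move: (_`!) => x1; nia.
move=> E; transitivity ('C(n, q + p)%:R * 'C(q + p, p)%:R *
  (c ^+ (n - p - q) * d ^+ q * d ^+ p * a p * e q)); first by ring.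
by rewrite E; ring.
Qed.

(** cos (pi / (n + 1))^n tends to 1, by 1 - cos th = O(th^2) and Bernoulli's
    inequality, while (1 - s) / s < 1. *)
Lemma exists_small_angle s : 1 / 2 < s <= 1 -> exists n : nat,
  let th := pi / n.+1%:R in
  [/\ 0 < sin th, 0 < cos th & 1 - s < s * cos th ^+ n].
Proof.
move=> /andP[s0 s1].
have E0 := expR_gt0 (1 : R).
have K0 : 0 <= 16 * expR 1 * s / (2 * s - 1) :> R.
  by rewrite divr_ge0 //; [rewrite mulr_ge0 // ?mulr_ge0 ?(ltW E0) //; lra | lra].
have := archi_boundP K0; set m := Num.bound _ => mK.
(* The summand 3 gives n + 1 >= 4 > pi, hence th < 1. *)
pose n := (m + 3)%N; exists n => th.
have n0 : 0 < n.+1%:R :> R by rewrite ltr0n.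
have nK : 16 * expR 1 * s / (2 * s - 1) < n.+1%:R.
  by apply: lt_le_trans mK _; rewrite ler_nat /n; lia.
have n4 : 4 <= n.+1%:R :> R by rewrite (ler_nat _ 4) /n; lia.
have pi4 := @pihalf_lt2 R; have pi0 := @pi_gt0 R.
have th0 : 0 < th by rewrite divr_gt0.
have thn : th * n.+1%:R = pi by rewrite divfK // gt_eqF.
have th1 : th < 1 by nra.
have th_pi : th < pi / 2 by have := @pihalf_ge1 R; lra.
have c0 : 0 < cos th by rewrite cos_gt0_pihalf // th_pi andbT; lra.
split=> //; first by rewrite sin_gt0_pihalf // th0.
have th1' : `|th| <= 1 by rewrite gtr0_norm // ltW.
have := cos_taylor 2 th1'.
rewrite !big_ord_recl big_ord0 /= !mul0r !addr0 !mul1r !expr0 invr1 mulr1.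
rewrite (gtr0_norm th0) => ct.
have cb : 1 - expR 1 * th ^+ 2 <= cos th.
  by move: ct; rewrite ler_norml => /andP[ct _]; lra.
have c1 := cos_le1 th.
have bern k : 1 - k%:R * (1 - cos th) <= cos th ^+ k.
  elim: k => [|k IH]; first by rewrite expr0; lra.
  have h1 := ler_wpM2l (ltW c0) IH.
  have h2 : 0 <= k%:R * (1 - cos th) ^+ 2 by rewrite mulr_ge0 ?sqr_ge0.
  by rewrite exprS -[k.+1%:R]natr1; lra.
have := bern n.
have : n%:R * (1 - cos th) <= 16 * expR 1 / n.+1%:R.
  rewrite ler_pdivlMr //.
  have : 1 - cos th <= expR 1 * th ^+ 2 by lra.
  have nn : n%:R <= n.+1%:R :> R by rewrite ler_nat.
  have n00 : 0 <= n%:R :> R by [].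
  move=> h1; apply: (@le_trans _ _ (n.+1%:R * (expR 1 * th ^+ 2) * n.+1%:R)).
    by rewrite ler_wpM2r ?(ltW n0) // ler_pM //; lra.
  rewrite (_ : _ * _ * _ = expR 1 * (th * n.+1%:R) ^+ 2); last by ring.
  have pi16 : pi ^+ 2 <= 16 :> R.
    rewrite (_ : 16 = 4 ^+ 2); last by ring.
    by apply: lerXn2r; rewrite ?nnegrE ?(ltW pi0) //; lra.
  by rewrite thn [16 * _]mulrC ler_wpM2l // ltW.
have : s * (16 * expR 1 / n.+1%:R) < 2 * s - 1.
  by rewrite mulrA ltr_pdivrMr // mulrC [_ * n.+1%:R]mulrC -ltr_pdivrMr //; lra.
set X := 16 * _ / _ => h1 h2 h3.
by nra.
Qed.

(** Termwise integration: (n + 1) C(n, k) = (k + 1) C(n + 1, k + 1) turns the left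
    side into the imaginary part of (cos th + i sin th)^(n+1). *)
Lemma binsum_sinc th n :
  n.+1%:R * sin th *
    binsum (cos th) (sin th) n (fun k => re_ipow k / k.+1%:R) =
  sin (n.+1%:R * th).
Proof.
have im0 : im_ipow 0 = 0 by rewrite /im_ipow mul0r.
rewrite -(de_moivre th n.+1).2 /binsum [in RHS]big_ord_recl [im_ipow _]im0 mulr0 add0r.
rewrite mulr_sumr; apply: eq_bigr => k _; rewrite lift0 im_ipowS subSS exprS.
have := congr1 (fun x => x%:R : R) (mul_bin_diag n.+1 k); rewrite /= !natrM => E.
have -> : 'C(n.+1, k.+1)%:R = n.+1%:R * 'C(n, k)%:R / k.+1%:R :> R.
  by rewrite E mulrAC divff ?mul1r // pnatr_eq0.
ring.
Qed.

(** The numbers M p = re_ipow p * a p, nonnegative by assumption, are the moments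
    of a would-be measure of which the quotient is the characteristic function.
    Passing to imaginary arguments turns the defining recursion into
    the same one with cos and sin y / y in place of cosh and sinhc. Its
    weighted sum [binsum] at th = pi / (n + 1) is 0 on one side; on the other
    it is a sum of the M p with weights involving
    s cos th^m + (1 - s) cos (m th) >= s cos th^n - (1 - s) > 0, and M 0 = 1. *)
Lemma no_nonneg_moments s (a : nat -> R) : 1 / 2 < s <= 1 ->
  (forall k, \sum_(p < k.+1) 'C(k, p)%:R * a p * heron_coef s (k - p) =
     (~~ odd k)%:R / k.+1%:R) ->
  ~ (forall m, 0 <= (-1) ^+ m * a (m + m)%N).
Proof.
move=> s12 aE apos.
pose M p := re_ipow p * a p.
have M0 p : 0 <= M p.
  rewrite /M /re_ipow; case: (boolP (odd p)) => podd; first by rewrite !mul0r.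
  by rewrite mul1r; have := apos p./2; rewrite addnn even_halfK.
pose e q := s * (q == 0%N)%:R + (1 - s) * re_ipow q.
have ME k : \sum_(p < k.+1) 'C(k, p)%:R * M p * e (k - p)%N = re_ipow k / k.+1%:R.
  transitivity (re_ipow k * ((~~ odd k)%:R / k.+1%:R)); last first.
    by rewrite /re_ipow; case: odd => /=; rewrite ?mul0r // !mul1r.
  rewrite -aE mulr_sumr; apply: eq_bigr => p _.
  have pk : (p <= k)%N by rewrite -ltnS.
  have -> : re_ipow k = re_ipow (p + (k - p)) by rewrite subnKC.
  move: (k - p)%N => q; rewrite /M /e /heron_coef.
  suff h : re_ipow (p + q) * (s * (q == 0)%:R + (1 - s) * (~~ odd q)%:R) =
    re_ipow p * (s * (q == 0)%:R + (1 - s) * re_ipow q).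
    transitivity ('C(k, p)%:R * a p *
      (re_ipow p * (s * (q == 0)%:R + (1 - s) * re_ipow q))); first by ring.
    by rewrite -h; ring.
  rewrite /re_ipow oddD halfD; have [->|q0] := eqVneq q 0%N.
    by rewrite /= addbF andbF add0n addn0 expr0; ring.
  case: (boolP (odd q)) => qo; first by rewrite /= !mulr0 !mul0r ?mulr0 addr0 !mulr0.
  by rewrite addbF andbF add0n exprD /=; ring.
have e0 : e 0%N = 1 by rewrite /e /re_ipow /= expr0; ring.
have r0 : re_ipow 0 = 1 by rewrite /re_ipow /= mul1r.
have M00 : M 0%N = 1.
  by have := ME 0%N; rewrite big_ord1 bin0 e0 r0 !mul1r mulr1 invr1.
have [n /= [sn0 cs0 sn]] := exists_small_angle s12.
set th := pi / _ in sn0 cs0 sn.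
have : binsum (cos th) (sin th) n (fun k => re_ipow k / k.+1%:R) = 0.
  have nz : n.+1%:R * sin th != 0 by rewrite mulf_neq0 ?pnatr_eq0 // gt_eqF.
  by apply: (mulfI nz); rewrite binsum_sinc mulr0 /th mulrC divfK ?sinpi // pnatr_eq0.
rewrite -(eq_binsum _ _ _ ME) binsum_convolution => /eqP; apply/negP.
have eB m : binsum (cos th) (sin th) m e = s * cos th ^+ m + (1 - s) * cos (m%:R * th).
  rewrite -(de_moivre th m).1 /binsum mulr_sumr /e.
  under eq_bigr do rewrite mulrDr.
  rewrite big_split /=; congr (_ + _); last by apply: eq_bigr => j _; ring.
  rewrite big_ord_recl big1 => [|j _]; last by rewrite /= !mulr0.
  by rewrite /= bin0 subn0 expr0; ring.
have Bpos m : (m <= n)%N -> 0 < binsum (cos th) (sin th) m e.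
  move=> mn; rewrite eB.
  have : cos th ^+ n <= cos th ^+ m by rewrite ler_wiXn2l ?cos_le1 // ltW.
  have := cos_geN1 (m%:R * th); have /andP[? ?] := s12; nra.
rewrite gt_eqF // big_ord_recl; apply: ltr_pwDl.
  rewrite bin0 expr0 !mul1r subn0 mulr_gt0 ?Bpos //.
  by rewrite M00.
apply: sumr_ge0 => p _; rewrite mulr_ge0 //; last by rewrite ltW // Bpos // leq_subr.
by rewrite mulr_ge0 // mulr_ge0 // exprn_ge0 // ltW.
Qed.

End NoNonnegativeMoments.

(** * Necessity *)

Section Necessity.
Variable R : realType.
Local Open Scope complex_scope.
Local Open Scope sesquilinear_scope.

Lemma psdmx_diag n (l : 'rV[R]_n) : (forall i, 0 <= l 0 i) ->
  psdmx (diag_mx (map_mx (real_complex R) l)).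
Proof.
move=> l0; split.
  apply: realsym_hermsym.
    by apply/is_hermitianmxP; rewrite scale1r tr_diag_mx map_mx_id.
  apply/mxOverP => i j; rewrite !mxE; case: eqP => _; last exact: real0.
  by rewrite mulr1n; apply/complex_realP; exists (l 0 i).
move=> x; rewrite mul_mx_diag !mxE sumr_ge0 // => i _; rewrite !mxE.
by rewrite mulrAC normc_sqr -rmorphM ler0c mulr_ge0 ?sqr_ge0.
Qed.

Lemma meanmx_diag (M : R -> R -> R) n (l : 'rV[R]_n) (X : 'M[R[i]]_n) :
  (forall i, 0 <= l 0 i) ->
  let S := diag_mx (map_mx (real_complex R) l) in
  meanmx M S S X = schur (fun i j => M (l 0 i) (l 0 j)) X.
Proof.
move=> l0 S; have u1 : (1%:M : 'M[R[i]]_n) \is unitarymx.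
  by apply/unitarymxP; rewrite trmx1 map_mx1 mulmx1.
have SE : S = 1%:M *m S *m 1%:M^t* by rewrite trmx1 map_mx1 mul1mx mulmx1.
have Sp := psdmx_diag l0.
rewrite (meanmxE M X Sp Sp u1 u1 SE SE) trmx1 map_mx1 !mul1mx !mulmx1.
by apply/matrixP => i j; rewrite !mxE.
Qed.

(** Take S = T diagonal with eigenvalues exp (2 u_i), and X such that the Heron
    side is an arbitrary given matrix Y: the inequality for the operator norm says
    that multiplication by the quotient of the kernels is a contraction. *)
Lemma heronquot_psd (s : R) : 0 <= s <= 1 ->
  (forall n (N : 'M[R[i]]_n -> R) (S T X : 'M[R[i]]_n),
     (0 < n)%N -> unitarily_invariant_norm N -> psdmx S -> psdmx T ->
     N (meanmx (@logmean R) S T X) <= N (meanmx (heronmean s) S T X)) ->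
  forall n (u v : 'I_n -> R),
    0 <= \sum_i \sum_j v i * v j * heronquot s (u i - u j).
Proof.
move=> /andP[s0 s1] H [|n] u v; first by rewrite big_ord0.
apply: (@contractive_multiplier_psd _ _ (fun i j => heronquot s (u i - u j)));
  first by []; [move=> i | move=> Y].
  by rewrite subrr /heronquot /sinhc eqxx cosh0 mulr1 subrKC invr1 mulr1.
pose l : 'rV[R]_n.+1 := \row_i expR (2 * u i).
have l0 i : 0 <= l 0 i by rewrite mxE expR_ge0.
have D0 t : s + (1 - s) * cosh t != 0.
  by rewrite gt_eqF //; have := cosh_ge1 t; nra.
pose X := schur (fun i j => (heronmean s (l 0 i) (l 0 j))^-1) Y.
have Sp := psdmx_diag l0; set S := diag_mx _ in Sp.
have eL : meanmx (@logmean R) S S X =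
    schur (fun i j => heronquot s (u i - u j)) Y.
  rewrite (meanmx_diag _ X l0) schurM; apply: eq_schur => i j.
  rewrite !mxE logmean_expR2 heronmean_expR2 /heronquot.
  by field; rewrite D0 gt_eqF // expR_gt0.
have eH : meanmx (heronmean s) S S X = Y.
  rewrite (meanmx_diag _ X l0) schurM -[RHS]schur1; apply: eq_schur => i j.
  rewrite !mxE heronmean_expR2 divff // mulf_neq0 ?D0 //.
  by rewrite gt_eqF // expR_gt0.
have := H _ _ _ _ X isT (opnorm_uinvariant R n.+1) Sp Sp.
by rewrite eL eH.
Qed.

Lemma necessity (s : R) : 0 <= s <= 1 ->
  (forall n (N : 'M[R[i]]_n -> R) (S T X : 'M[R[i]]_n),
     (0 < n)%N -> unitarily_invariant_norm N -> psdmx S -> psdmx T ->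
     N (meanmx (@logmean R) S T X) <= N (meanmx (heronmean s) S T X)) ->
  s <= 1 / 2.
Proof.
move=> s01 H; rewrite leNgt; apply/negP => s12.
have e0 : heron_coef s 0 = 1 by rewrite /heron_coef /=; ring.
have [a aE] := binomial_convolution_inverse
  (fun k => (~~ odd k)%:R / k.+1%:R) e0.
have s1 : 1 / 2 < s <= 1 by case/andP: s01 => _ ->; rewrite s12.
apply: (no_nonneg_moments s1 aE) => m.
exact: psd_taylor_sign s01 aE (heronquot_psd s01 H).
Qed.

End Necessity.

Theorem theorem3p6 (R : realType) (s : R) (hs : 0 <= s <= 1) :
  (forall (n : nat) (N : 'M[R[i]]_n -> R) (S T X : 'M[R[i]]_n),
     (0 < n)%N -> unitarily_invariant_norm N -> psdmx S -> psdmx T ->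
     N (meanmx (@logmean R) S T X) <= N (meanmx (heronmean s) S T X))
  <-> 0 <= s <= 1 / 2.
Proof.
split=> [H|s12 n N S T X _ hN Sp Tp]; last exact: sufficiency.
by case/andP: (hs) => -> _; exact: necessity hs H.
Qed.
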